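(* Let $G$ be a finite group and $k$ a formally real closed field (i.e. a real closed field). Let $A$ be a $G$-Galois algebra over $k$ with $|\mathrm{Aut}_G(A)|=|G|$. Then either $A\cong\mathrm{Ind}_S^G(A(k(i)_\sigma[N],\gamma))$ for a semi-real torsor datum $(S,k(i),N,\sigma,\gamma)$ for $G$, or $A\cong\mathrm{Ind}_N^G(A(k_\sigma[N],\gamma_\sigma))$ for a real torsor datum $(N,\sigma)$ for $G$.
   Context: A field is formally real if $-1$ is not a sum of squares; it is real closed if moreover it has no proper formally real algebraic extension. For a formally real $k$, $k(i)$ ($i^2=-1$) is Galois over $k$ with group $\mathbb Z/2$. $\mu_2=\{\pm1\}$, $\mu_4=\{\pm1,\pm i\}$. For a group $G$, a $G$-algebra is a $k$-algebra with $G$ acting by algebra automorphisms; $\mathrm{Aut}_G(A)$ = $G$-equivariant algebra automorphisms. A $G$-Galois algebra over $k$ is a nonzero $G$-algebra $A$ with $A^G=k$ and $A\otimes_kA\to\prod_{g\in G}A$, $x\otimes y\mapsto(x(g\cdot y))_g$, bijective. $\mathrm{Ind}_S^G(B)=\{r:G\to B\mid r(sg)=s\cdot r(g)\}$ with pointwise operations and $(g\cdot r)(x)=r(xg)$. Cohomology: for $N\trianglelefteq S$ and an abelian group $M$ (multiplicative) with $S$-action $m\mapsto{}^gm$ trivial on $N$, $Z^2_S(N,M)$ consists of pairs $(\sigma,\gamma)$, $\sigma:N\times N\to M$, $\gamma:S\times N\to M$, equal to $1$ when an argument is $1$, with $\sigma(x,y)\sigma(xy,z)=\sigma(y,z)\sigma(x,yz)$,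 ${}^g\sigma(x,y)\gamma(g,xy)=\sigma(gxg^{-1},gyg^{-1})\gamma(g,x)\gamma(g,y)$, $\gamma(gh,x)={}^g\gamma(h,x)\gamma(g,hxh^{-1})$; coboundaries $\partial\tau=((x,y)\mapsto\tau(x)\tau(y)/\tau(xy),(g,x)\mapsto{}^g\tau(x)/\tau(gxg^{-1}))$, $\tau:N\to M$, $\tau(1)=1$; $H^2_S(N,M)$ = cocycles mod coboundaries. $Z^2_S(N,M)_n$: cocycles with $\gamma(x,y)=\sigma(x,y)\sigma(xy,x^{-1})\sigma(x,x^{-1})^{-1}$ for $x,y\in N$. $H^2(N,M)$ is ordinary cohomology with trivial action. A normalized 2-cocycle $\sigma$ on $N$ is non-degenerate if $1$ is the only $x$ with $\sigma(x,y)=\sigma(y,x)$ for all $y$ commuting with $x$; $\mathrm{Alt}(\sigma)(x,y)=\sigma(x,y)/\sigma(y,x)$. Galois datum for $G$: $(S,K,N,\sigma,\gamma)$, $S\le G$, $N\trianglelefteq S$, $K\supseteq k$ finite Galois with fixed $S/N\cong\mathrm{Gal}(K|k)$ (write $\bar g$), $\mathrm{char}\,k\nmid|N|$, $(\sigma,\gamma)\in Z^2_S(N,K^* )_n$, $\sigma$ non-degenerate. $A(K_\sigma[N],\gamma)$: twisted group algebra over $K$ (basis $u_x$, $u_xu_y=\sigma(x,y)u_{xy}$) as a $k$-algebra with $S$-action $g\cdot(\alpha u_x)=\bar g(\alpha)\gamma(g,x)u_{gxg^{-1}}$. A torsor datum is a Galois datum with: $S$ abelian; $S=N\oplus\mathrm{Gal}(K|k)$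 (internal direct sum with a complement mapping isomorphically to $S/N\cong\mathrm{Gal}(K|k)$, identified with it); $k$ contains a primitive root of unity of order $\exp(N)$; $\sigma$ is $k^*$-valued; $\gamma:S\times N\to k^*$ bimultiplicative, trivial on $\mathrm{Gal}(K|k)\times N$, equal to $\mathrm{Alt}(\sigma)$ on $N\times N$; $N,S\trianglelefteq G$; for all $g\in G$, $(\sigma^g,\gamma^g)$ cohomologous to $(\sigma,\gamma)$ in $H^2_S(N,K^* )$, where $\sigma^g(x,y)=\sigma(gxg^{-1},gyg^{-1})$, $\gamma^g(s,x)=\gamma(gsg^{-1},gxg^{-1})$. A real torsor datum for $G$ is a pair $(N,\sigma)$ with $N$ a normal elementary abelian $2$-subgroup of $G$, $\sigma\in Z^2(N,\mu_2)$ non-degenerate, and $[\sigma]=[\sigma^g]$ in $H^2(N,\mu_2)$ for all $g\in G$; its associated algebra uses $\gamma_\sigma(x,y)=\sigma(x,y)\sigma(xy,x^{-1})\sigma(x,x^{-1})^{-1}$ ($x,y\in N$), i.e. the Galois datum $(N,k,N,\sigma,\gamma_\sigma)$. A semi-real torsor datum for $G$ is a torsor datum $(S,k(i),N,\sigma,\gamma)$ with $N$ an abelian $2$-group, $\sigma$ taking values in $\mu_2$, and $(\sigma^g,\gamma^g)$ cohomologous to $(\sigma,\gamma)$ in $H^2_S(N,\mu_4)$ for all $g\in G$. *)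

(* Defs.v *)
From HB Require Import structures.
From mathcomp Require Import all_boot all_order all_algebra all_fingroup all_solvable all_field.
From mathcomp Require Import complex.
Set Implicit Arguments. Unset Strict Implicit. Unset Printing Implicit Defensive.
Import Order.TTheory GRing.Theory Num.Theory.
Local Open Scope ring_scope.

Section GAlg.
Variables (k : fieldType) (gT : finGroupType) (A : falgType k).
Local Open Scope group_scope.

Definition is_Galgebra (act : gT -> 'End(A)) : Prop :=
  (forall g (x y : A), act g (x * y)%R = (act g x * act g y)%R) /\
  (forall g, act g 1%R = 1%R) /\
  (forall x : A, act 1 x = x) /\
  (forall g h (x : A), act (g * h) x = act g (act h x)).

(* The map A (x)_k A -> prod_{g in G} A, x (x) y |-> (x (g.y))_g, where
   A (x)_k A is identified with 'M[k]_n (n = dim A) through the basis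
   vbasis {:A} of A: the matrix M stands for sum_{i,j} M i j e_i (x) e_j. *)
Definition galois_map (act : gT -> 'End(A)) (M : 'M[k]_(\dim {:A})) : {ffun gT -> A} :=
  [ffun g => \sum_(i < \dim {:A}) \sum_(j < \dim {:A})
      (M i j *: ((vbasis {:A})`_i * act g (vbasis {:A})`_j))%R].

Definition is_Galois_algebra (act : gT -> 'End(A)) : Prop :=
  is_Galgebra act /\
  (0 < \dim {:A})%N /\
  (forall a : A, (forall g, act g a = a) -> exists c : k, a = c%:A) /\
  injective (galois_map act) /\
  (forall F : {ffun gT -> A}, exists M, galois_map act M = F).

Definition is_GAut (act : gT -> 'End(A)) (f : 'End(A)) : Prop :=
  (forall x y : A, f (x * y)%R = (f x * f y)%R) /\ f 1%R = 1%R /\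
  bijective f /\ (forall g (x : A), f (act g x) = act g (f x)).

Definition card_AutG_eq (act : gT -> 'End(A)) (n : nat) : Prop :=
  exists s : seq 'End(A), uniq s /\ size s = n /\
    (forall f, f \in s <-> is_GAut act f).

End GAlg.

Section Twisted.
(* K : field containing k via inj; bar g = the automorphism \bar g of K. *)
Variables (k K : fieldType) (inj : k -> K) (gT : finGroupType).
Variables (bar : gT -> K -> K) (N S : {group gT}) (sigma gamma : gT -> gT -> K).
Local Open Scope group_scope.

(* Elements of the twisted group algebra K_sigma[N] are coefficient functions
   b : gT -> K supported on N (b x = coefficient of u_x). *)
Definition tw_elt (b : {ffun gT -> K}) : Prop := forall x, x \notin N -> b x = 0%R.
Definition tw_one : {ffun gT -> K} := [ffun x => if x == 1 then 1%R else 0%R].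
Definition tw_add (b c : {ffun gT -> K}) : {ffun gT -> K} := [ffun x => (b x + c x)%R].
Definition tw_scale (a : k) (b : {ffun gT -> K}) : {ffun gT -> K} := [ffun x => (inj a * b x)%R].
(* (sum_x b_x u_x)(sum_y c_y u_y) = sum_{x,y} b_x c_y sigma(x,y) u_{xy} *)
Definition tw_mul (b c : {ffun gT -> K}) : {ffun gT -> K} :=
  [ffun z => \sum_(x in N) (b x * c (x^-1 * z)%g * sigma x (x^-1 * z)%g)%R].
(* g.(alpha u_x) = bar g (alpha) gamma(g,x) u_{g x g^-1} *)
Definition tw_act (g : gT) (b : {ffun gT -> K}) : {ffun gT -> K} :=
  [ffun y => (bar g (b (g^-1 * y * g)%g) * gamma g (g^-1 * y * g)%g)%R].

Definition ind_elt (r : {ffun gT -> {ffun gT -> K}}) : Prop :=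
  (forall g, tw_elt (r g)) /\ (forall s g, s \in S -> r (s * g) = tw_act s (r g)).

Definition iso_Ind (A : falgType k) (act : gT -> 'End(A)) : Prop :=
  exists phi : A -> {ffun gT -> {ffun gT -> K}},
    (forall a, ind_elt (phi a)) /\
    (forall a b, phi (a + b)%R = [ffun g => tw_add (phi a g) (phi b g)]) /\
    (forall (c : k) a, phi (c *: a)%R = [ffun g => tw_scale c (phi a g)]) /\
    (forall a b, phi (a * b)%R = [ffun g => tw_mul (phi a g) (phi b g)]) /\
    phi 1%R = [ffun _ => tw_one] /\
    (forall h a, phi (act h a) = [ffun x => phi a (x * h)]) /\
    injective phi /\
    (forall r, ind_elt r -> exists a, phi a = r).

Definition Z2S_n : Prop :=
  (forall x y, x \in N -> y \in N -> sigma x y != 0%R) /\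
  (forall g x, g \in S -> x \in N -> gamma g x != 0%R) /\
  (forall x, x \in N -> sigma 1 x = 1%R /\ sigma x 1 = 1%R) /\
  (forall g x, g \in S -> x \in N -> gamma 1 x = 1%R /\ gamma g 1 = 1%R) /\
  (forall x y z, x \in N -> y \in N -> z \in N ->
     (sigma x y * sigma (x * y)%g z = sigma y z * sigma x (y * z)%g)%R) /\
  (forall g x y, g \in S -> x \in N -> y \in N ->
     (bar g (sigma x y) * gamma g (x * y)%g
      = sigma (g * x * g^-1)%g (g * y * g^-1)%g * gamma g x * gamma g y)%R) /\
  (forall g h x, g \in S -> h \in S -> x \in N ->
     gamma (g * h) x = (bar g (gamma h x) * gamma g (h * x * h^-1)%g)%R) /\
  (forall x y, x \in N -> y \in N ->
     gamma x y = (sigma x y * sigma (x * y)%g x^-1%g / sigma x x^-1%g)%R).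

Definition nondeg : Prop :=
  forall x, x \in N ->
    (forall y, y \in N -> commute x y -> sigma x y = sigma y x) -> x = 1.

(* (sigma^g, gamma^g) cohomologous to (sigma, gamma) in H^2_S(N, M), where
   M is the subgroup of K^* given by the predicate inM. *)
Definition cohom_conj (inM : K -> Prop) (g : gT) : Prop :=
  exists tau : gT -> K, tau 1 = 1%R /\ (forall x, x \in N -> inM (tau x)) /\
    (forall x y, x \in N -> y \in N ->
       sigma (g * x * g^-1) (g * y * g^-1)
       = (sigma x y * (tau x * tau y / tau (x * y)%g))%R) /\
    (forall s x, s \in S -> x \in N ->
       gamma (g * s * g^-1) (g * x * g^-1)
       = (gamma s x * (bar s (tau x) / tau (s * x * s^-1)%g))%R).

End Twisted.

Section RealCase.
Variables (k : rcfType) (gT : finGroupType).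
Local Open Scope group_scope.

Definition conj_or_id (eps : gT -> bool) (g : gT) : k[i] -> k[i] :=
  fun a => if eps g then conjc a else a.

Definition inC (a : k) : k[i] := (a%:C)%C.

(* Semi-real torsor datum (S, k(i), N, sigma, gamma) for G = gT.
   eps : S -> Z/2 = Gal(k(i)|k) is the identification S/N ~ Gal(k(i)|k)
   (eps g = true iff \bar g is complex conjugation). *)
Definition semi_real_torsor_datum (S N : {group gT}) (eps : gT -> bool)
    (sigma gamma : gT -> gT -> k[i]) : Prop :=
  let bar := conj_or_id eps in
  N <| S /\
  (forall s t, s \in S -> t \in S -> eps (s * t) = eps s (+) eps t) /\
  (forall s, s \in S -> (~~ eps s) = (s \in N)) /\
  (exists s, s \in S /\ eps s) /\
  Z2S_n bar N S sigma gamma /\ nondeg N sigma /\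
  abelian S /\
  (exists T : {group gT}, N \x T = S /\
     (forall t x, t \in T -> x \in N -> gamma t x = 1%R)) /\
  (exists zeta : k, (exponent N).-primitive_root zeta) /\
  (forall x y, x \in N -> y \in N -> exists c : k, sigma x y = inC c) /\
  (forall g x, g \in S -> x \in N -> exists c : k, c != 0%R /\ gamma g x = inC c) /\
  (forall g h x, g \in S -> h \in S -> x \in N ->
     gamma (g * h) x = (gamma g x * gamma h x)%R) /\
  (forall g x y, g \in S -> x \in N -> y \in N ->
     gamma g (x * y) = (gamma g x * gamma g y)%R) /\
  (forall x y, x \in N -> y \in N -> gamma x y = (sigma x y / sigma y x)%R) /\
  N <| [set: gT] /\ S <| [set: gT] /\
  (forall g, cohom_conj bar N S sigma gamma (fun a => a != 0%R) g) /\
  abelian N /\ 2.-group N /\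
  (forall x y, x \in N -> y \in N -> sigma x y = 1%R \/ sigma x y = (-1)%R) /\
  (forall g, cohom_conj bar N S sigma gamma (fun a => (a ^+ 4 = 1)%R) g).

Definition gamma_of (sigma : gT -> gT -> k) : gT -> gT -> k :=
  fun x y => (sigma x y * sigma (x * y)%g x^-1%g / sigma x x^-1%g)%R.

Definition real_torsor_datum (N : {group gT}) (sigma : gT -> gT -> k) : Prop :=
  N <| [set: gT] /\ 2.-abelem N /\
  (forall x y, x \in N -> y \in N -> sigma x y = 1%R \/ sigma x y = (-1)%R) /\
  (forall x, x \in N -> sigma 1 x = 1%R /\ sigma x 1 = 1%R) /\
  (forall x y z, x \in N -> y \in N -> z \in N ->
     (sigma x y * sigma (x * y)%g z = sigma y z * sigma x (y * z)%g)%R) /\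
  nondeg N sigma /\
  (forall g, g \in [set: gT] -> exists tau : gT -> k, tau 1 = 1%R /\
     (forall x, x \in N -> tau x = 1%R \/ tau x = (-1)%R) /\
     (forall x y, x \in N -> y \in N ->
        sigma (g * x * g^-1) (g * y * g^-1)
        = (sigma x y * (tau x * tau y / tau (x * y)%g))%R)).

End RealCase.

(* Main.v *)
(* Let A be G-Galois and let (x_i), (y_i) satisfy sum_i x_i g(y_i) = [g = 1].
   These coordinates split A = (+)_g A_g with A_g = {b | g(y) b = b y for all y}
   (the Miyashita-Ulbrich grading), A_1 being the centre; this replaces the
   Wedderburn and Skolem-Noether theorems.  The centre is reduced, so it has a
   minimal idempotent e, and L = e Z(A) is a field, equal to k or k(i).  Let S be
   the stabiliser of e and N <= S the pointwise stabiliser of L.  Then eA_g = 0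
   for g outside N, and for x in N it is a line L u_x with u_x invertible in eA:
   if it were 0, then comparing the average over N with the projection to A_1
   would contradict the linear independence of the maps a |-> g(a) c_g.  Hence
   eA is a twisted group algebra of N over L and A = Ind_S^G(eA).

   Write L = k[j] with j = e or j^2 = -e.  Every f in Aut_G(A) maps j into its
   G-orbit, of size [G : N], and the f fixing j embed into the L-valued
   characters of N, of which there are at most |N| by Dedekind.  So
   |Aut_G(A)| = |G| makes every t(j) of the form f(j) and makes the characters
   coming from Aut_G(A) separate the points of N.  Over k the characters have
   values +-1, so N is elementary abelian.  Over k(i) one gets N abelian and
   s x s^-1 = x^-1 for s in S - N; an automorphism with f(j) = -j makes
   Alt(sigma) real, so N is again elementary abelian and S is abelian.  Rescaling
   to u_x^2 = +-e (with u_x fixed by some s in S - N over k(i)) makes sigma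
   +-1-valued, and the automorphisms f with f(j) = t(j) give the cohomology
   relations. *)
Require Import Defs.
From HB Require Import structures.
From mathcomp Require Import all_boot all_order all_algebra all_fingroup all_solvable all_field.
From mathcomp Require Import complex.
From mathcomp Require boolp.
From mathcomp Require Import ring.
Set Implicit Arguments. Unset Strict Implicit. Unset Printing Implicit Defensive.
Import Order.TTheory GRing.Theory Num.Theory.
Local Open Scope ring_scope.

(** * Independence and number of the characters of a finite group *)

Section Dedekind.
Variables (F : fieldType) (gT : finGroupType) (N : {group gT}).

(** Vanishing off [N] makes equality of characters on [N] the same as equality of functions. *)
Definition character_on (chi : {ffun gT -> F}) :=
  [/\ chi 1%g = 1, forall x y, x \in N -> y \in N -> chi (x * y)%g = chi x * chi y
    & forall x, x \notin N -> chi x = 0].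

(** Dedekind's argument, by induction on [s]; once all other coefficients vanish, evaluation at 1
    kills that of [chi0]. *)
Lemma character_indep (s : seq {ffun gT -> F}) (c : {ffun gT -> F} -> F) :
  uniq s -> (forall chi, chi \in s -> character_on chi) ->
  (forall x, x \in N -> \sum_(chi <- s) c chi * chi x = 0) ->
  forall chi, chi \in s -> c chi = 0.
Proof.
elim: s c => [|chi0 s IHs] c //= /andP[chi0s us] hs hc.
have [c1 cM c0] := hs chi0 (mem_head _ _).
have cs0 chi : chi \in s -> c chi = 0.
  move=> chis.
  have [d1 dM d0] : character_on chi by apply: hs; rewrite inE chis orbT.
  have [y yN ny] : exists2 y, y \in N & chi y != chi0 y.
    apply/exists_inP; apply: contraNT chi0s => /exists_inPn h.
    suff -> : chi0 = chi by [].
    apply/ffunP => y; have [yN|yN] := boolP (y \in N); last by rewrite c0 ?d0.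
    by have:= h y yN; rewrite negbK => /eqP.
  have : c chi * (chi y - chi0 y) = 0.
    apply: (IHs (fun chi => c chi * (chi y - chi0 y))) => // [psi ps|x xN].
      by apply: hs; rewrite inE ps orbT.
    (* The relation at [y * x] minus [chi0 y] times the relation at [x] has no [chi0] term. *)
    have h1 := hc (y * x)%g (groupM yN xN).
    have : chi0 y * (\sum_(chi <- chi0 :: s) c chi * chi x)
           = \sum_(chi <- chi0 :: s) c chi * chi (y * x)%g by rewrite h1 hc ?mulr0.
    rewrite !big_cons cM // mulrDr mulr_sumr mulrCA => /addrI h2.
    apply/eqP; rewrite (eq_big_seq (fun psi => c psi * psi (y * x)%g - chi0 y * (c psi * psi x))).
      by rewrite sumrB -h2 subrr.
    move=> psi ps; have [_ pM _] : character_on psi by apply: hs; rewrite inE ps orbT.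
    by rewrite pM // mulrBr mulrBl mulrA [chi0 y * _]mulrCA mulrA.
  by move/eqP; rewrite mulf_eq0 subr_eq0 (negPf ny) orbF => /eqP.
move=> chi; rewrite inE => /predU1P[->|]; last exact: cs0.
have := hc 1%g (group1 N); rewrite big_cons big_seq big1 => [|psi ps].
  by rewrite addr0 c1 mulr1.
by rewrite cs0 // mul0r.
Qed.

(** By independence the matrix [M] of values has full row rank, whence the bound. If it is square it
    has a left inverse, so no two of its columns agree. *)
Lemma character_count (s : seq {ffun gT -> F}) :
  uniq s -> (forall chi, chi \in s -> character_on chi) ->
  (size s <= #|N|)%N /\
  (size s = #|N| -> forall x y, x \in N -> y \in N ->
     (forall chi, chi \in s -> chi x = chi y) -> x = y).
Proof.
move=> us hs.
pose M := \matrix_(i < size s, l < #|N|) (tnth (in_tuple s) i) (enum_val l).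
have Mfree : row_free M.
  apply: inj_row_free => w wM0; apply/rowP => i; rewrite mxE.
  pose c chi := \sum_(i | tnth (in_tuple s) i == chi) w 0 i.
  have tinj : injective (tnth (in_tuple s)) by apply/tuple_uniqP.
  have cE l : c (tnth (in_tuple s) l) = w 0 l.
    by rewrite /c (bigD1 l) //= big1 ?addr0 // => l' /andP[/eqP/tinj-> /eqP].
  rewrite -cE; apply: (character_indep (s := s)) => // [x xN|]; last exact: mem_tnth.
  rewrite -[s in LHS]/(tval (in_tuple s)) big_tuple.
  have /rowP/(_ (enum_rank_in xN x)) := wM0; rewrite !mxE => {2}<-.
  by apply: eq_bigr => l _; rewrite cE mxE enum_rankK_in.
have rM : \rank M = size s by apply/eqP.
split=> [|sN x y xN yN hxy]; first by rewrite -rM rank_leq_col.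
have /row_fullP[D DM] : row_full M by rewrite /row_full rM sN.
apply/eqP; apply: contraT => xy.
set lx := enum_rank_in xN x; set ly := enum_rank_in yN y.
have nl : lx != ly.
  apply: contraNneq xy => /(congr1 enum_val); rewrite !enum_rankK_in // => ->.
  by [].
have /matrixP DMe := DM.
have := DMe lx lx; have := DMe lx ly; rewrite !mxE eqxx (negPf nl) /=.
under eq_bigr do rewrite mxE enum_rankK_in // -hxy ?mem_tnth //.
under [in X in _ -> X -> _]eq_bigr do rewrite mxE enum_rankK_in //.
by move=> -> /eqP; rewrite eq_sym oner_eq0.
Qed.

End Dedekind.

(** * Galois coordinates, the trace and the Miyashita-Ulbrich grading *)

Definition central (R : nzRingType) (z : R) := forall y, y * z = z * y.

Section GaloisCoordinates.
Variables (k : numFieldType) (gT : finGroupType) (A : falgType k).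
Variable act : gT -> 'End(A).
Hypothesis act_galg : is_Galgebra act.
Hypothesis act_inv : forall a, (forall g, act g a = a) -> exists c : k, a = c%:A.
Variables (I : finType) (xc yc : I -> A).
Hypothesis coordP : forall g, \sum_i xc i * act g (yc i) = (g == 1%g)%:R.

Lemma galgM g a b : act g (a * b) = act g a * act g b.
Proof. by case: act_galg. Qed.

Lemma galg1 g : act g 1 = 1.
Proof. by case: act_galg => _ []. Qed.

Lemma galg_act1 a : act 1%g a = a.
Proof. by case: act_galg => _ [_ []]. Qed.

Lemma galg_actM g h a : act (g * h)%g a = act g (act h a).
Proof. by case: act_galg => _ [_ [_]]. Qed.

Lemma galgK g : cancel (act g) (act g^-1%g).
Proof. by move=> a; rewrite -galg_actM mulVg galg_act1. Qed.

Lemma galgVK g : cancel (act g^-1%g) (act g).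
Proof. by move=> a; rewrite -galg_actM mulgV galg_act1. Qed.

Lemma galg_eq0 g a : (act g a == 0) = (a == 0).
Proof. by apply/eqP/eqP => [/(congr1 (act g^-1%g))|->]; rewrite ?galgK linear0. Qed.

Lemma coordV g : \sum_i act g (xc i) * yc i = (g == 1%g)%:R.
Proof.
rewrite -[LHS](galgVK g) linear_sum /=.
under eq_bigr do rewrite galgM galgK.
rewrite coordP eq_invg1; case: eqP => _; [exact: galg1 | exact: linear0].
Qed.

(** Evaluate the relation at [act h^-1 (yc i)], multiply by [xc i] on the left and sum over [i]: the
    coordinates leave only [c h]. *)
Lemma act_indep (c : gT -> A) :
  (forall a, \sum_g act g a * c g = 0) -> forall h, c h = 0.
Proof.
move=> c0 h.
have: \sum_i xc i * (\sum_g act g (act h^-1%g (yc i)) * c g) = 0.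
  by rewrite big1 // => i _; rewrite c0 mulr0.
under eq_bigr do rewrite mulr_sumr.
rewrite exchange_big /= (bigD1 h) //= [X in _ + X]big1 => [|g gh].
  rewrite addr0; under eq_bigr do rewrite -galg_actM mulrA.
  by rewrite -mulr_suml coordP mulgV eqxx mul1r.
under eq_bigr do rewrite -galg_actM mulrA.
by rewrite -mulr_suml coordP -eq_mulgV1 (negPf gh) mul0r.
Qed.

Definition tr a := \sum_g act g a.

Lemma act_tr h a : act h (tr a) = tr a.
Proof.
rewrite /tr linear_sum [RHS](reindex_inj (mulgI h)) /=.
by apply: eq_bigr => g _; rewrite galg_actM.
Qed.

Lemma tr_scalar a : exists c : k, tr a = c%:A.
Proof. by apply: act_inv => h; apply: act_tr. Qed.

Lemma tr_central a : central (tr a).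
Proof. by move=> b; have [c ->] := tr_scalar a; rewrite -scalerAr mulr1 -scalerAl mul1r. Qed.

(** The families [xc] and [yc] behave as dual bases for the form [tr (a * b)]. *)
Lemma tr_expand_l a : a = \sum_i xc i * tr (yc i * a).
Proof.
under eq_bigr do rewrite /tr mulr_sumr.
rewrite exchange_big /= (bigD1 1%g) //= [X in _ + X]big1 => [|g g1].
  rewrite addr0; under eq_bigr do rewrite galgM mulrA.
  by rewrite -mulr_suml coordP eqxx galg_act1 mul1r.
under eq_bigr do rewrite galgM mulrA.
by rewrite -mulr_suml coordP (negPf g1) mul0r.
Qed.

Lemma tr_expand_r a : a = \sum_i tr (a * xc i) * yc i.
Proof.
under eq_bigr do rewrite /tr mulr_suml.
rewrite exchange_big /= (bigD1 1%g) //= [X in _ + X]big1 => [|g g1].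
  rewrite addr0; under eq_bigr do rewrite galgM -mulrA.
  by rewrite -mulr_sumr coordV eqxx galg_act1 mulr1.
under eq_bigr do rewrite galgM -mulrA.
by rewrite -mulr_sumr coordV (negPf g1) mulr0.
Qed.

(** If all [tr (a * xc i)] vanished, [tr_expand_r] would give [a = 0]; a nonzero trace is a scalar
    and can be normalised. *)
Lemma tr_nondeg a : a != 0 -> exists b, tr (a * b) = 1.
Proof.
move=> a0; have [i ti] : exists i, tr (a * xc i) != 0.
  apply/existsP; apply: contraR a0 => /existsPn h.
  rewrite [a]tr_expand_r big1 // => i _.
  by move/negPn/eqP: (h i) => ->; rewrite mul0r.
have [c ec] := tr_scalar (a * xc i).
have c0 : c != 0 by apply: contraNneq ti => c0; rewrite ec c0 scale0r.
exists (c^-1 *: xc i); rewrite -scalerAr.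
have -> : tr (c^-1 *: (a * xc i)) = c^-1 *: tr (a * xc i).
  by rewrite /tr scaler_sumr; apply: eq_bigr => g _; rewrite linearZ.
by rewrite ec scalerA mulVf // scale1r.
Qed.

(* The Miyashita-Ulbrich grading; gcomp g is the projection onto degree g. *)
Definition graded g b := forall a, act g a * b = b * a.
Definition gcomp g a := \sum_i act g (xc i) * a * yc i.

Lemma graded1 z : graded 1%g z <-> central z.
Proof. by split=> hz a; have := hz a; rewrite galg_act1. Qed.

Lemma gradedM g h a b : graded g a -> graded h b -> graded (g * h)%g (a * b).
Proof. by move=> ha hb c; rewrite galg_actM mulrA ha -mulrA hb mulrA. Qed.

Lemma gradedMz g a z : graded g a -> central z -> graded g (a * z).
Proof. by move=> ha /graded1 hz; rewrite -[g]mulg1; apply: gradedM. Qed.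

Lemma graded_act g h a : graded g a -> graded (h * g * h^-1)%g (act h a).
Proof. by move=> ha b; rewrite !galg_actM -galgM ha galgM galgVK. Qed.

(** Dual-basis computation: write [b * xc j] through the [xc i], move the scalar traces past [a],
    and resum over [j] to get [yc i * b]. *)
Lemma comp_graded g a : graded g (gcomp g a).
Proof.
move=> b; rewrite /gcomp mulr_sumr mulr_suml.
transitivity (\sum_j \sum_i act g (xc i) * a * (tr (yc i * b * xc j) * yc j)).
  apply: eq_bigr => j _; rewrite !mulrA -galgM [b * xc j]tr_expand_l linear_sum /=.
  rewrite !mulr_suml; apply: eq_bigr => i _.
  rewrite galgM act_tr !mulrA; congr (_ * _).
  by rewrite -!mulrA; congr (_ * _); rewrite tr_central.
rewrite exchange_big; apply: eq_bigr => i _ /=.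
by rewrite -mulr_sumr -mulrA -tr_expand_r.
Qed.

Lemma comp_sum g (J : finType) (P : pred J) (F : J -> A) :
  gcomp g (\sum_(j | P j) F j) = \sum_(j | P j) gcomp g (F j).
Proof.
rewrite /gcomp exchange_big; apply: eq_bigr => i _ /=.
by rewrite mulr_sumr mulr_suml.
Qed.

Lemma sum_comp a : \sum_g gcomp g a = a.
Proof.
rewrite /gcomp exchange_big /=.
transitivity (\sum_i a * (tr (xc i) * yc i)).
  apply: eq_bigr => i _; rewrite -mulr_suml -mulr_suml mulrA; congr (_ * _).
  by rewrite -[LHS]/(tr _ * _) tr_central.
by rewrite -mulr_sumr -[in RHS](mulr1 a) [in RHS](tr_expand_r 1); under [in RHS]eq_bigr do rewrite mul1r.
Qed.

Lemma comp_gradedE g h a : graded g a -> gcomp h a = if h == g then a else 0.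
Proof.
move=> ha; rewrite /gcomp; under eq_bigr do rewrite -mulrA -ha mulrA.
rewrite -mulr_suml -[X in X * _](galgVK h) linear_sum /=.
under eq_bigr do rewrite galgM galgK -galg_actM.
rewrite coordP -eq_invg_mul invgK; case: eqP => _; last by rewrite linear0 mul0r.
by rewrite galg1 mul1r.
Qed.

Lemma comp_mulr g a z : central z -> gcomp g (a * z) = gcomp g a * z.
Proof.
by move=> hz; rewrite /gcomp mulr_suml; apply: eq_bigr => i _; rewrite -!mulrA hz.
Qed.

Lemma comp_act h a : gcomp 1%g (act h a) = act h (gcomp 1%g a).
Proof.
rewrite -{1}[a]sum_comp linear_sum comp_sum (bigD1 1%g) //= [X in _ + X]big1 => [|g g1].
  by rewrite addr0 (comp_gradedE _ (graded_act h (comp_graded 1%g a))) mulg1 mulgV eqxx.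
rewrite (comp_gradedE _ (graded_act h (comp_graded g a))).
by rewrite eq_sym -eq_mulgV1 -(inj_eq (mulgI h^-1%g)) mulKg mulVg (negPf g1).
Qed.

(** Take [b] with [tr (u * b) = 1] and keep its component of degree [g^-1]. Its product with [u] is
    the degree 1 component of [u * b]; if that vanished, so would the degree 1 component of the
    trace, which is 1. *)
Lemma graded_pair g u : graded g u -> u != 0 ->
  exists2 b, graded g^-1%g b & u * b != 0.
Proof.
move=> hu u0; have [b tb] := tr_nondeg u0.
exists (gcomp g^-1%g b); first exact: comp_graded.
have -> : u * gcomp g^-1%g b = gcomp 1%g (u * b).
  rewrite /gcomp mulr_sumr; apply: eq_bigr => i _.
  by rewrite galg_act1 !mulrA -hu galgVK.
apply/eqP => c0; have /eqP := oner_neq0 A; apply.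
rewrite -tb -[LHS](sum_comp).
have hc : central (tr (u * b)) := tr_central _.
move/graded1 in hc; rewrite (bigD1 1%g) //= [X in _ + X]big1 => [|g' g1]; last first.
  by rewrite (comp_gradedE _ hc) (negPf g1).
rewrite addr0 /tr comp_sum big1 // => h _.
by rewrite comp_act c0 linear0.
Qed.

(** * The centre is reduced and has a minimal idempotent *)

Lemma central_act g (z : A) : central z -> central (act g z).
Proof. by move=> hz a; rewrite -[a](galgVK g) -!galgM hz. Qed.

(** For [z != 0], multiply 1 by the conjugates of [z] in turn as long as the product stays nonzero.
    The result [w] is killed by every conjugate, as their squares vanish, and a trace
    [tr (z * b) = 1] then gives [w = 0]. *)
Lemma central_reduced (z : A) : central z -> z * z = 0 -> z = 0.
Proof.
move=> hz zz; apply/eqP; apply: contraT => z0.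
have [w w0 hw] : exists2 w : A, w != 0 & forall g, g \in enum gT -> act g z * w = 0.
  elim: (enum gT) => [|g s [w w0 hw]]; first by exists 1; rewrite ?oner_neq0.
  have [gw|gw] := eqVneq (act g z * w) 0.
    by exists w => // h; rewrite inE => /predU1P[->|/hw].
  exists (act g z * w) => // h; rewrite inE => /predU1P[->|/hw hhw].
    by rewrite mulrA -galgM zz linear0 mul0r.
  by rewrite mulrA central_act // -mulrA hhw mulr0.
have [b tb] := tr_nondeg z0; case/eqP: w0; rewrite -[w]mul1r -tb mulr_suml big1 // => g _.
by rewrite galgM -central_act // -mulrA hw ?mem_enum // mulr0.
Qed.

(** Take a nonzero central [z] with zA of least dimension; it is divisible by each of its nonzero
    central multiples. For [z * z], nonzero by reducedness, this gives [z = z * z * v] and the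
    idempotent [z * v]; for multiples of the form [w * e] it gives inverses. *)
Lemma exists_block : exists e : A,
  [/\ central e, e * e = e, e != 0 &
      forall z, central z -> z * e != 0 -> exists2 w, central w & z * w = e].
Proof.
pose d (z : A) : nat := \dim (limg (amull z)).
have ex (n : nat) (z : A) : central z -> z != 0 -> (d z <= n)%N -> exists z0, [/\ central z0, z0 != 0 &
    forall w, central w -> w != 0 -> (d z0 <= d w)%N].
  elim: n z => [|n IHn] z hz z0 dz.
    by exists z; split=> // w hw w0; apply: leq_trans dz _.
  have [[w [hw w0 dw]]|nw] := boolp.EM (exists w, [/\ central w, w != 0 & (d w < d z)%N]).
    by apply: (IHn w) => //; rewrite -ltnS; apply: leq_trans dw _.
  exists z; split=> // w hw w0; rewrite leqNgt; apply/negP => dw.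
  by apply: nw; exists w.
have h1 : @central A 1 by move=> a; rewrite mulr1 mul1r.
have [z [hz z0 zmin]] := ex (d 1) 1 h1 (oner_neq0 A) (leqnn _).
have amullE u v : amull u v = u * v by rewrite lfunE.
have divP (w w1 : A) : central w -> w != 0 -> w = z * w1 -> exists2 v, central v & z = w * v.
  move=> hw w0 ew.
  have sub : (limg (amull w) <= limg (amull z))%VS.
    apply/subvP => b /memv_imgP[c _ ->]; rewrite amullE ew -mulrA -amullE.
    exact: memv_img (memvf _).
  have /eqP eqwz : limg (amull w) == limg (amull z) by rewrite eqEdim sub zmin.
  have /memv_imgP[v _] : z \in limg (amull w).
    by rewrite eqwz -{1}[z]mulr1 -amullE memv_img ?memvf.
  (* The quotient is made central by passing to its degree 1 component. *)
  rewrite amullE => ev; exists (gcomp 1%g v); first exact/graded1/comp_graded.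
  have/graded1 hz1 := hz.
  by rewrite -hw -comp_mulr // hw -ev (comp_gradedE _ hz1) eqxx.
have centralM (u v : A) : central u -> central v -> central (u * v).
  by move=> /graded1 hu hv; apply/graded1/gradedMz.
have zz0 : z * z != 0 by apply: contraNneq z0 => /central_reduced->.
have [v hv ev] := divP _ z (centralM _ _ hz hz) zz0 erefl.
exists (z * v); split.
- exact: centralM.
- by rewrite mulrA -[z * v * z]mulrA hz mulrA -ev.
- by apply: contraNneq z0 => e0; rewrite ev -mulrA e0 mulr0.
move=> w hw we0.
have ew : w * (z * v) = z * (w * v) by rewrite !mulrA hz.
have [t ht et] := divP _ _ (centralM _ _ hw (centralM _ _ hz hv)) we0 ew.
exists (z * v * t * v).
  exact: (centralM _ _ (centralM _ _ (centralM _ _ hz hv) ht) hv).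
by rewrite 2!mulrA -et.
Qed.

Definition stab (a : A) := [set g | act g a == a].

Lemma stab_group_set a : group_set (stab a).
Proof.
apply/group_setP; split=> [|g h]; rewrite !inE ?galg_act1 // => /eqP ga /eqP ha.
by rewrite galg_actM ha ga.
Qed.
Canonical stab_group a := Group (stab_group_set a).

Lemma stabP g a : reflect (act g a = a) (g \in stab a).
Proof. by rewrite inE; apply: eqP. Qed.

Lemma centralM (a b : A) : central a -> central b -> central (a * b).
Proof. by move=> /graded1 ha hb; apply/graded1/gradedMz. Qed.

(** * The block eA, its field eZ(A) and its homogeneous units *)

Section Block.
Variables e j : A.
Hypotheses (ce : central e) (ee : e * e = e) (e_neq0 : e != 0).
Hypothesis eZ_field :
  forall z, central z -> z * e != 0 -> exists2 w, central w & z * w = e.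
Hypotheses (cj : central j) (je : j * e = j).
(* iota identifies F with eZ(A) = k j^2 + k j; this presentation covers both
   j = e and j^2 = - e. *)
Variables (F : fieldType) (iota : F -> A) (re im : F -> k).
Hypothesis iotaD : forall a b, iota (a + b) = iota a + iota b.
Hypothesis iotaM : forall a b, iota (a * b) = iota a * iota b.
Hypothesis iota1 : iota 1 = e.
Hypothesis iotaE : forall a, iota a = re a *: (j * j) + im a *: j.
Hypothesis iota_onto : forall z, central z -> z * e = z -> exists a, iota a = z.

Local Notation N := (stab j).
Local Notation S := (stab e).

Lemma iota_central a : central (iota a).
Proof.
move=> b; rewrite iotaE mulrDr mulrDl -!scalerAr -!scalerAl [b * j]cj.
by rewrite ((centralM cj cj) b).
Qed.

Lemma iotae a : iota a * e = iota a.
Proof. by rewrite -iota1 -iotaM mulr1. Qed.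

Lemma iota0 : iota 0 = 0.
Proof. by apply: (addrI (iota 0)); rewrite -iotaD !addr0. Qed.

Lemma iotaN a : iota (- a) = - iota a.
Proof. by apply: (addrI (iota a)); rewrite -iotaD !subrr iota0. Qed.

Lemma iota_eq0 a : (iota a == 0) = (a == 0).
Proof.
apply/eqP/eqP => [a0|->]; last exact: iota0.
apply/eqP; apply: contraT => an0; case/eqP: e_neq0.
by rewrite -iota1 -(mulfV an0) iotaM a0 mul0r.
Qed.

Lemma iota_inj : injective iota.
Proof.
move=> a b ab; apply/eqP; rewrite -subr_eq0 -iota_eq0.
by rewrite iotaD iotaN ab subrr.
Qed.

Lemma kappa_exists : exists kappa : A -> F,
  forall z, central z -> z * e = z -> iota (kappa z) = z.
Proof.
suff /boolp.choice[f fP] : forall z, exists a, central z -> z * e = z -> iota a = z.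
  by exists f.
move=> z.
have [[hz ze]|nz] := boolp.EM (central z /\ z * e = z).
  by have [a <-] := iota_onto hz ze; exists a.
by exists 0 => hz ze; case: nz.
Qed.
Definition kappa := sval (boolp.cid kappa_exists).
Lemma kappaP z : central z -> z * e = z -> iota (kappa z) = z.
Proof. exact: (svalP (boolp.cid kappa_exists)). Qed.

Lemma iotaK : cancel iota kappa.
Proof. by move=> a; apply: iota_inj; rewrite kappaP ?iotae //; apply: iota_central. Qed.

Lemma iota_fix g a : g \in N -> act g (iota a) = iota a.
Proof. by move/stabP=> gj; rewrite iotaE linearD !linearZ /= galgM gj. Qed.

Lemma sub_stab : N \subset S.
Proof. by apply/subsetP => g gN; apply/stabP; rewrite -iota1 iota_fix. Qed.

Lemma idem_block p : central p -> p * p = p -> p * e != 0 -> p * e = e.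
Proof. by move=> hp pp /eZ_field[] // w _ <-; rewrite mulrA pp. Qed.

(** If the product is nonzero, minimality of [e] used for [g] and for [g^-1] makes it equal to both
    [e] and [act g e]. *)
Lemma block_orth g : g \notin S -> act g e * e = 0.
Proof.
move=> gS; apply/eqP; apply: contraNT gS => n0; apply/stabP.
have h1 : act g e * e = e.
  by apply: idem_block => //; [exact: central_act | rewrite -galgM ee].
have h2 : act g^-1%g e * e = e.
  apply: idem_block; [exact: central_act | by rewrite -galgM ee |].
  by rewrite -(galg_eq0 g) galgM galgVK -ce.
by rewrite -[RHS]h1 ce -{1}h2 galgM galgVK.
Qed.

(** A trace [tr (e * b) = 1] writes 1 as a combination of the conjugates of [e]. *)
Lemma block_faithful a : (forall t, act t e * a = 0) -> a = 0.
Proof.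
move=> h; have [b tb] := tr_nondeg e_neq0.
rewrite -[a]mul1r -tb mulr_suml big1 // => t _.
by rewrite galgM -(central_act t ce) -mulrA h mulr0.
Qed.

(** Use [act g z * b = b * z]. Outside S take [z = e] and apply [block_orth]; in S but outside N
    take [z = j], so that [b] is killed by [act g j - j], which is invertible in eZ(A). *)
Lemma graded_notin g b : g \notin N -> graded g b -> b * e = b -> b = 0.
Proof.
move=> gN hb be; have [gS|gS] := boolP (g \in S); last first.
  by rewrite -be ce -[X in _ * X]be -hb mulrA -ce block_orth // mul0r.
have hz : central (act g j - j).
  by move=> a; rewrite mulrBr mulrBl cj (central_act g cj).
have ze : (act g j - j) * e = act g j - j.
  by rewrite mulrBl je -{1}(stabP _ _ gS) -galgM je.
have [|w hw wz] := eZ_field hz.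
  by rewrite ze subr_eq0; move: gN; rewrite inE.
have zb : (act g j - j) * b = 0 by rewrite mulrBl hb cj subrr.
by rewrite -be ce -wz hw -mulrA zb mulr0.
Qed.

Lemma graded_e g b : graded g b -> graded g (b * e).
Proof. by move=> hb; apply: gradedMz. Qed.

Lemma block_decomp b : b * e = \sum_(g in N) gcomp g b * e.
Proof.
rewrite -{1}[b](sum_comp) mulr_suml (bigID (mem N)) /= [X in _ + X]big1 ?addr0 // => g gN.
apply: (graded_notin gN); first exact/graded_e/comp_graded.
by rewrite -mulrA ee.
Qed.

(** N fixes all of eZ(A), which contains [act s^-1 j]. *)
Lemma stabJ s x : s \in S -> x \in N -> (s * x * s^-1)%g \in N.
Proof.
move=> sS xN; apply/stabP; rewrite !galg_actM.
have [|a ha] := iota_onto (central_act s^-1%g cj).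
  by rewrite -(stabP _ _ (groupVr sS)) -galgM je.
by rewrite -ha iota_fix // ha galgVK.
Qed.

(* On the block, the average over N is the projection gcomp 1 onto eZ: on a
   component of degree g != 1 the average is central of degree 1. *)
Lemma sum_stab a : \sum_(h in N) act h a * e = #|N|%:R *: (gcomp 1%g a * e).
Proof.
have key g b : graded g b ->
    \sum_(h in N) act h b * e = if g == 1%g then #|N|%:R *: (b * e) else 0.
  move=> hb; case: eqP => [g1|/eqP g1].
    rewrite g1 in hb; move/graded1 in hb.
    have [c cb] := iota_onto (centralM hb ce) (etrans (esym (mulrA _ _ _)) (congr1 _ ee)).
    rewrite (eq_bigr (fun=> b * e)) ?sumr_const ?scaler_nat // => h hN.
    by rewrite -cb -(iota_fix c hN) cb galgM (stabP _ _ (subsetP sub_stab h hN)).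
  set z := \sum_(h in N) _.
  have ze : z * e = z.
    by rewrite mulr_suml; apply: eq_bigr => h _; rewrite -mulrA ee.
  have zfix g' : g' \in N -> act g' z = z.
    move=> g'N; rewrite linear_sum [RHS](reindex_inj (mulgI g')) /=.
    apply: eq_big => h; first by rewrite groupMl.
    by move=> hN; rewrite galgM (stabP _ _ (subsetP sub_stab g' g'N)) galg_actM.
  have hz : central z.
    move=> c; have h1 : (c * e) * z = z * (c * e).
      rewrite block_decomp mulr_suml mulr_sumr; apply: eq_bigr => g' g'N.
      by rewrite -(graded_e (comp_graded g' c)) zfix.
    by rewrite -{1}ze [z * e]ce mulrA h1 [c * e]ce mulrA ze.
  move/graded1 in hz; have := comp_gradedE 1%g hz; rewrite eqxx => <-.
  rewrite comp_sum big1 // => h _.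
  rewrite (comp_gradedE _ (graded_e (graded_act h hb))).
  by rewrite eq_sym -eq_mulgV1 -(inj_eq (mulgI h^-1%g)) mulKg mulVg (negPf g1).
transitivity (\sum_g \sum_(h in N) act h (gcomp g a) * e).
  rewrite exchange_big; apply: eq_bigr => h _ /=.
  by rewrite -mulr_suml -linear_sum sum_comp.
rewrite (bigD1 1%g) //= (key _ _ (comp_graded _ _)) eqxx [X in _ + X]big1 ?addr0 // => g g1.
by rewrite (key _ _ (comp_graded _ _)) (negPf g1).
Qed.

Definition unit_at (g : gT) (u v : A) := [/\ graded g u, u * e = u, v * e = v, u * v = e & v * u = e].

Lemma unit_atV g (u v : A) : unit_at g u v -> graded g^-1%g v.
Proof.
move=> [gu ue ve uv vu] b.
have h1 : v * b = v * b * (u * v) by rewrite uv -mulrA ce mulrA ve.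
have h2 : b * u = u * act g^-1%g b by rewrite -gu galgVK.
by rewrite h1 -mulrA [b * _]mulrA h2 -!mulrA [v * (u * _)]mulrA vu -ce -mulrA ve.
Qed.

(** A nonzero [u] of degree [g] in the block has a partner of degree [g^-1] with nonzero central
    product, invertible in eZ(A); the product in the other order is a nonzero central idempotent,
    hence [e]. *)
Lemma unit_at_exists g : g \in N -> exists u v : A, unit_at g u v.
Proof.
move=> gN.
have [[u [gu ue u0]]|nu] := boolp.EM (exists u : A, [/\ graded g u, u * e = u & u != 0]).
  have [b gb ub] := graded_pair gu u0.
  have hub : central (u * b) by apply/graded1; rewrite -(mulgV g); apply: gradedM.
  have ube : u * b * e != 0 by rewrite -mulrA ce mulrA ue.
  have [w hw ubw] := eZ_field hub ube.
  pose v := b * w * e.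
  have uv : u * v = e by rewrite /v !mulrA ubw ee.
  have ve : v * e = v by rewrite /v -!mulrA ee.
  have hvu : central (v * u).
    apply/graded1; rewrite -(mulVg g); apply: gradedM => //.
    by rewrite /v; apply: gradedMz => //; apply: gradedMz.
  clearbody v; exists u, v; split=> //.
  have vue : v * u * e = e.
    apply: idem_block => //.
      by rewrite mulrA -[v * u * v]mulrA uv ve.
    apply: contraNneq u0 => vu0.
    have h : u * (v * u * e) = u by rewrite !mulrA uv -ce !ue.
    by rewrite -h vu0 mulr0.
  by rewrite -{1}ue mulrA vue.
have g0 a : gcomp g a * e = 0.
  apply/eqP; apply: contraT => n0; case: nu; exists (gcomp g a * e); split=> //.
    exact/graded_e/comp_graded.
  by rewrite -mulrA ee.
(* If no such [u] exists, [sum_stab] becomes a linear relation between the maps [act h]: splitting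
   [xc i] into degrees moves [a] to the left as [act h a]. Its coefficient at [g] is [e], since
   [gcomp g (xc i) * e = 0]. *)
pose c h := (h \in N)%:R *: e - #|N|%:R *: \sum_i gcomp h (xc i) * yc i * e.
have c0 : forall a, \sum_h act h a * c h = 0.
  move=> a; rewrite /c; under eq_bigr do rewrite mulrBr -!scalerAr.
  rewrite sumrB; apply/eqP; rewrite subr_eq0; apply/eqP.
  transitivity (\sum_(h in N) act h a * e).
    rewrite [RHS]big_mkcond; apply: eq_bigr => h _.
    by case: (h \in N); rewrite ?scale1r ?scale0r.
  rewrite sum_stab -scaler_sumr; congr (_ *: _).
  under [RHS]eq_bigr do rewrite mulr_sumr.
  rewrite exchange_big /gcomp mulr_suml; apply: eq_bigr => i _ /=.
  rewrite galg_act1 -{1}[xc i]sum_comp !mulr_suml; apply: eq_bigr => h _.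
  by rewrite -comp_graded !mulrA.
have := act_indep c0 g; rewrite /c gN scale1r big1 ?scaler0 ?subr0 => [e0|i _].
  by move: e_neq0; rewrite e0 eqxx.
by rewrite -mulrA ce mulrA g0 mul0r.
Qed.

Lemma graded_unitE g (u v b : A) : unit_at g u v -> graded g b -> b * e = b ->
  exists c, b = iota c * u.
Proof.
move=> uP gb be; have gv := unit_atV uP; case: uP => gu ue ve uv vu.
have hbv : central (b * v) by apply/graded1; rewrite -(mulgV g); apply: gradedM.
have [|c hc] := iota_onto hbv; first by rewrite -mulrA ve.
by exists c; rewrite hc -mulrA vu be.
Qed.

(** * The block as a twisted group algebra, and A as its induced algebra *)

Section Units.
Variables (u v : gT -> A).
Hypothesis uP : forall x, x \in N -> unit_at x (u x) (v x).

Definition coef (b : A) (x : gT) : F :=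
  if x \in N then kappa (gcomp x b * e * v x) else 0.

Lemma u_graded x : x \in N -> graded x (u x).
Proof. by case/uP. Qed.

Lemma ue x : x \in N -> u x * e = u x.
Proof. by case/uP. Qed.

Lemma uv x : x \in N -> u x * v x = e.
Proof. by case/uP. Qed.

Lemma iotau_graded x c : x \in N -> graded x (iota c * u x).
Proof.
by move=> xN; rewrite -[iota c * _]iota_central; apply: gradedMz;
   [apply: u_graded | apply: iota_central].
Qed.

Lemma iotau_inj x c d : x \in N -> iota c * u x = iota d * u x -> c = d.
Proof.
move=> xN /(congr1 ( *%R^~ (v x))); rewrite -!mulrA uv // !iotae; exact: iota_inj.
Qed.

Lemma coefE b (c : gT -> F) : b * e = \sum_(x in N) iota (c x) * u x ->
  forall y, y \in N -> coef b y = c y.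
Proof.
move=> hb y yN; rewrite /coef yN -comp_mulr // hb comp_sum (bigD1 y) //= [X in _ + X]big1.
  by rewrite addr0 (comp_gradedE _ (iotau_graded _ yN)) eqxx -mulrA uv // iotae iotaK.
move=> x /andP[xN xy]; rewrite (comp_gradedE _ (iotau_graded _ xN)).
by rewrite eq_sym (negPf xy).
Qed.

Lemma coef_notin b x : x \notin N -> coef b x = 0.
Proof. by rewrite /coef => /negPf->. Qed.

Lemma coefP b : b * e = \sum_(x in N) iota (coef b x) * u x.
Proof.
rewrite block_decomp; apply: eq_bigr => x xN.
have [|c hc] := graded_unitE (uP xN) (graded_e (comp_graded x b)).
  by rewrite -mulrA ee.
by rewrite /coef xN hc -mulrA uv // iotae iotaK.
Qed.

Lemma coef_graded x b : x \in N -> graded x b -> b * e = b -> b = iota (coef b x) * u x.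
Proof.
move=> xN gb be; have [c hc] := graded_unitE (uP xN) gb be.
suff <- : c = coef b x by [].
by rewrite /coef xN (comp_gradedE _ gb) eqxx be hc -mulrA uv // iotae iotaK.
Qed.

Lemma coef_inj a b : coef a =1 coef b -> a * e = b * e.
Proof. by move=> h; rewrite !coefP; apply: eq_bigr => x _; rewrite h. Qed.

Lemma coefD a b x : coef (a + b) x = coef a x + coef b x.
Proof.
have [xN|xN] := boolP (x \in N); last by rewrite !coef_notin // addr0.
apply: (coefE (c := fun x => coef a x + coef b x)) => //.
rewrite mulrDl !coefP -big_split; apply: eq_bigr => y _ /=.
by rewrite iotaD mulrDl.
Qed.

Variables (inj : k -> F) (bar : gT -> F -> F) (sigma gamma : gT -> gT -> F).
Hypothesis iota_scale : forall c, iota (inj c) = c *: e.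
Hypothesis act_iota : forall s a, s \in S -> act s (iota a) = iota (bar s a).
Hypothesis u1 : u 1%g = e.
Hypothesis uM : forall x y, x \in N -> y \in N ->
  u x * u y = iota (sigma x y) * u (x * y)%g.
Hypothesis uact : forall s x, s \in S -> x \in N ->
  act s (u x) = iota (gamma s x) * u (s * x * s^-1)%g.

Lemma coefZ c b x : coef (c *: b) x = inj c * coef b x.
Proof.
have [xN|xN] := boolP (x \in N); last by rewrite !coef_notin // mulr0.
apply: (coefE (c := fun x => inj c * coef b x)) => //.
rewrite -scalerAl coefP scaler_sumr; apply: eq_bigr => y _.
by rewrite iotaM iota_scale -!scalerAl -[e * _]ce iotae.
Qed.

Lemma coef1 x : coef 1 x = if x == 1%g then 1 else 0.
Proof.
have [xN|xN] := boolP (x \in N); last first.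
  by rewrite coef_notin //; case: eqP xN => // ->; rewrite group1.
apply: (coefE (c := fun x => if x == 1%g then 1 else 0)) => //.
rewrite mul1r (bigD1 1%g) ?group1 //= big1 => [|y /andP[_ /negPf->]].
  by rewrite eqxx iota1 u1 ee addr0.
by rewrite iota0 mul0r.
Qed.

Lemma coefM a b z :
  coef (a * b) z = \sum_(x in N) coef a x * coef b (x^-1 * z)%g * sigma x (x^-1 * z)%g.
Proof.
have [zN|zN] := boolP (z \in N); last first.
  rewrite coef_notin // big1 // => x xN.
  by rewrite (@coef_notin b) ?mulr0 ?mul0r // groupMl ?groupV.
pose c z := \sum_(x in N) coef a x * coef b (x^-1 * z)%g * sigma x (x^-1 * z)%g.
apply: (coefE (c := c)) => // {z zN}.
have -> : a * b * e = (a * e) * (b * e) by rewrite -!mulrA -[e * (b * e)]ce -mulrA ee.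
rewrite [a * e]coefP [b * e]coefP mulr_suml.
under [RHS]eq_bigr do rewrite /c (big_morph iota iotaD iota0) mulr_suml.
rewrite exchange_big; apply: eq_bigr => x xN /=.
rewrite mulr_sumr [RHS](reindex_inj (mulgI x)) /=.
apply: eq_big => [y|y yN]; first by rewrite groupMl.
rewrite mulKg !iotaM -[X in _ = X]mulrA -uM // !mulrA; congr (_ * _).
by rewrite -!mulrA; congr (_ * _); rewrite iota_central.
Qed.

Lemma bar0 s : s \in S -> bar s 0 = 0.
Proof. by move=> sS; apply/eqP; rewrite -iota_eq0 -act_iota // iota0 linear0. Qed.

Lemma coef_act s b y : s \in S ->
  coef (act s b) y = bar s (coef b (s^-1 * y * s)%g) * gamma s (s^-1 * y * s)%g.
Proof.
move=> sS; have [yN|yN] := boolP (y \in N); last first.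
  rewrite coef_notin // (@coef_notin b) ?bar0 ?mul0r //.
  by apply: contra yN => /(stabJ sS); rewrite !mulgA mulgV mul1g mulgK.
pose c y := bar s (coef b (s^-1 * y * s)%g) * gamma s (s^-1 * y * s)%g.
apply: (coefE (c := c)) => // {y yN}.
rewrite -{1}(stabP _ _ sS) -galgM coefP linear_sum /=.
rewrite [RHS](reindex_inj (mulgI s)) [RHS](reindex_inj (mulIg s^-1%g)) /=.
apply: eq_big => [x|x xN].
  apply/idP/idP; rewrite mulgA; first exact: stabJ.
  move=> h.
  have := stabJ (groupVr sS) h.
  by rewrite invgK !mulgA mulVg mul1g mulgKV.
rewrite galgM act_iota // uact // /c !mulgA mulVg mul1g mulgKV.
by rewrite iotaM mulrA.
Qed.

(** The isomorphism records, for each [g], the coordinates of [act g a * e]; it is injective by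
    [block_faithful]. *)
Lemma twisted_iso : iso_Ind inj bar (stab_group j) (stab_group e) sigma gamma act.
Proof.
exists (fun a => [ffun g => [ffun x => coef (act g a) x]]).
split=> [a|].
  split=> [g x xN|s g sS]; first by rewrite !ffunE coef_notin.
  by apply/ffunP => y; rewrite !ffunE galg_actM coef_act.
split=> [a b|]; first by apply/ffunP => g; apply/ffunP => x; rewrite !ffunE linearD coefD.
split=> [c a|]; first by apply/ffunP => g; apply/ffunP => x; rewrite !ffunE linearZ coefZ.
split=> [a b|].
  apply/ffunP => g; apply/ffunP => x; rewrite !ffunE galgM coefM.
  by apply: eq_bigr => y _; rewrite !ffunE.
split; first by apply/ffunP => g; apply/ffunP => x; rewrite !ffunE galg1 coef1.
split=> [h a|]; first by apply/ffunP => g; apply/ffunP => x; rewrite !ffunE galg_actM.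
split=> [a b ab|r [r_tw r_ind]].
  apply/eqP; rewrite -subr_eq0; apply/eqP; apply: block_faithful => t.
  rewrite -[a - b](galgVK t) -galgM -ce linearB mulrBl (@coef_inj _ (act t^-1%g b)).
    by rewrite subrr linear0.
  move=> x; move/ffunP/(_ t^-1%g)/ffunP/(_ x): ab.
  by rewrite !ffunE.
pose psi (c : {ffun gT -> F}) := \sum_(x in N) iota (c x) * u x.
have psie c : psi c * e = psi c.
  by rewrite mulr_suml; apply: eq_bigr => x xN; rewrite -mulrA ue.
have psi_act s (c : {ffun gT -> F}) : s \in S -> (forall x, x \notin N -> c x = 0) ->
    act s (psi c) = psi (tw_act bar gamma s c).
  move=> sS c0; rewrite -[psi (tw_act _ _ _ _)]psie.
  rewrite -[psi c]psie galgM (stabP _ _ sS).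
  have cp (d : {ffun gT -> F}) x : tw_elt (stab_group j) d -> coef (psi d) x = d x.
    move=> hd; have [xN|xN] := boolP (x \in N).
      by apply: (coefE (c := d)) => //; apply: psie.
    by rewrite coef_notin // hd.
  apply: coef_inj => x; rewrite coef_act // !cp //.
    by rewrite ffunE.
  move=> y yN; rewrite ffunE c0 ?bar0 ?mul0r //.
  by apply: contra yN => /(stabJ sS); rewrite !mulgA mulgV mul1g mulgK.
(* After [act h] and projection to the block, the terms with [h * g^-1] outside S die by
   [block_orth]; the other [#|S|] terms all equal [psi (r h)] by equivariance of [r]. *)
exists (#|S|%:R^-1 *: \sum_g act g^-1%g (psi (r g))).
have key h : act h (#|S|%:R^-1 *: \sum_g act g^-1%g (psi (r g))) * e = psi (r h).
  rewrite linearZ -scalerAl linear_sum /= mulr_suml.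
  rewrite (reindex_inj invg_inj) (reindex_inj (mulgI h^-1%g)) /=.
  rewrite (bigID (mem S)) /= [X in _ + X]big1 => [|s sS].
    rewrite addr0 (eq_bigr (fun=> psi (r h))) => [|s sS].
      rewrite sumr_const -scaler_nat scalerA mulVf ?scale1r //.
      by rewrite pnatr_eq0 -lt0n cardG_gt0.
    rewrite -galg_actM invgK mulKVg -(stabP _ _ sS) -galgM psie psi_act //.
      by rewrite -r_ind // invMg invgK mulKVg.
    exact: r_tw.
  rewrite -galg_actM invgK mulKVg -psie galgM -mulrA block_orth ?mulr0 //.
apply/ffunP => h; apply/ffunP => x; rewrite !ffunE.
have [xN|xN] := boolP (x \in N); last by rewrite coef_notin // r_tw.
exact: (coefE (key h)).
Qed.

Lemma iotaCA a b c : b * (iota a * c) = iota a * (b * c).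
Proof. by rewrite mulrA iota_central mulrA. Qed.

(** Such a [u x] commutes with the block, hence with A, so it is nonzero of degree 1 as well as of
    degree [x]. Non-degeneracy of [sigma] rests on this. *)
Lemma unit_central x : x \in N -> (forall y, y \in N -> u x * u y = u y * u x) -> x = 1%g.
Proof.
move=> xN h; have hc : central (u x).
  move=> b; have h1 : b * u x = b * e * u x by rewrite -mulrA -[e * _]ce ue.
  have h2 : u x * b = u x * (b * e) by rewrite [b * e]ce mulrA ue.
  rewrite h1 h2 coefP mulr_suml mulr_sumr; apply: eq_bigr => y yN.
  by rewrite iotaCA h // mulrA.
move/graded1 in hc; have := comp_gradedE x hc.
rewrite (comp_gradedE x (u_graded xN)) eqxx; case: eqP => // _ u0.
by move: e_neq0; rewrite -(uv xN) u0 mul0r eqxx.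
Qed.

Lemma u_neq0 x : x \in N -> u x != 0.
Proof. by move=> xN; apply: contraNneq e_neq0 => u0; rewrite -(uv xN) u0 mul0r. Qed.

(** The identities are associativity, multiplicativity of the action and its group law, read on
    coefficients; the formula for [gamma] on N is the grading relation
    [act x (u y) * u x = u x * u y]. *)
Lemma twisted_Z2S_n : Z2S_n bar (stab_group j) (stab_group e) sigma gamma.
Proof.
have NS := subsetP sub_stab.
split=> [x y xN yN|].
  apply/eqP => s0; have /eqP := u_neq0 yN; apply.
  have := uM xN yN; rewrite s0 iota0 mul0r => /(congr1 ( *%R (v x))).
  have [_ _ _ _ vu] := uP xN.
  by rewrite mulrA vu mulr0 -ce ue.
split=> [g x gS xN|].
  rewrite -iota_eq0; apply/eqP => g0; have := u_neq0 xN; rewrite -(galg_eq0 g).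
  by rewrite uact // g0 mul0r eqxx.
split=> [x xN|].
  split; apply: (iotau_inj xN); rewrite iota1.
    by rewrite -{2}[x]mul1g -uM // u1.
  by rewrite -{2}[x]mulg1 -uM // u1 -ce.
split=> [g x gS xN|].
  split; [apply: (iotau_inj xN) | apply: (iotau_inj (group1 (stab_group j)))].
    have := uact (group1 _) xN; rewrite galg_act1 mul1g invg1 mulg1 => <-.
    by rewrite iota1 -ce ue.
  have := uact gS (group1 _); rewrite mulg1 mulgV => <-.
  by rewrite u1 iota1 ee; apply/stabP.
split=> [x y z xN yN zN|].
  apply: (iotau_inj (groupM (groupM xN yN) zN)).
  rewrite !iotaM -mulrA -uM ?groupM // mulrA -uM // -[iota _ * _ * _]mulrA.
  by rewrite -mulgA -uM ?groupM // -iotaCA -uM // mulrA.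
split=> [g x y gS xN yN|].
  apply: (iotau_inj (stabJ gS (groupM xN yN))).
  have xyJ : (g * (x * y) * g^-1 = g * x * g^-1 * (g * y * g^-1))%g.
    by rewrite !mulgA mulgKV.
  have := congr1 (act g) (uM xN yN).
  rewrite !galgM act_iota // !uact ?groupM // [RHS]mulrA -iotaM => <-.
  rewrite iotaCA -[_ * u _ * u _]mulrA uM ?stabJ // xyJ !mulrA -!iotaM.
  congr (iota _ * _).
  by rewrite [RHS]mulrC [sigma _ _ * _]mulrC mulrA.
split=> [g h x gS hS xN|x y xN yN].
  apply: (iotau_inj (stabJ (groupM gS hS) xN)); rewrite -uact ?groupM //.
  rewrite galg_actM uact // galgM act_iota // uact ?stabJ // mulrA -iotaM.
  by rewrite invMg !mulgA.
have s0 : sigma x x^-1%g != 0.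
  rewrite -iota_eq0; apply: contraNneq e_neq0 => s0.
  have := uM xN (groupVr xN); rewrite s0 mul0r => /(congr1 ( *%R (v x))).
  have [_ _ _ _ vu] := uP xN.
  rewrite mulrA vu mulr0 -ce ue ?groupV // => /eqP.
  by rewrite (negPf (u_neq0 (groupVr xN))).
apply: (mulIf s0); rewrite divfK //.
have xyN : (x * y * x^-1)%g \in stab_group j by rewrite !groupM ?groupV.
apply: (iotau_inj xyN).
have := u_graded xN (u y); rewrite uact ?NS // => /(congr1 ( *%R^~ (u x^-1%g))).
rewrite -[_ * u x * _]mulrA uM ?groupV // mulgV u1 -[_ * u _ * _]mulrA iotaCA.
rewrite [u _ * e]ue // mulrA -iotaM mulrC => ->.
by rewrite uM // -mulrA uM ?groupM ?groupV // mulrA iotaM.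
Qed.

End Units.

(** * Counting equivariant automorphisms by characters of N *)

Section Automorphisms.
Variables (u v : gT -> A).
Hypothesis uP : forall x, x \in N -> unit_at x (u x) (v x).

Lemma gaut_central f z : is_GAut act f -> central z -> central (f z).
Proof.
by move=> [fM [f1 [[g fK gK] fact]]] hz b; rewrite -[b]gK -!fM hz.
Qed.

Lemma gaut_graded f g b : is_GAut act f -> graded g b -> graded g (f b).
Proof.
by move=> [fM [f1 [[h fK hK] fact]]] gb a; rewrite -[a]hK -fact -!fM gb.
Qed.

Lemma uM_coef x y : x \in N -> y \in N ->
  u x * u y = iota (coef v (u x * u y) (x * y)%g) * u (x * y)%g.
Proof.
move=> xN yN; apply: (coef_graded uP); first exact: groupM.
  by apply: gradedM; apply: (u_graded uP).
by rewrite -mulrA (ue uP).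
Qed.

Definition chi (f : 'End(A)) := [ffun x => coef v (f (u x)) x].

Section Fixing.
Variable f : 'End(A).
Hypotheses (fG : is_GAut act f) (fj : f j = j).

Lemma gaut_iota a : f (iota a) = iota a.
Proof. by case: fG => fM _; rewrite iotaE linearD !linearZ /= fM fj. Qed.

Lemma gaut_u x : x \in N -> f (u x) = iota (chi f x) * u x.
Proof.
move=> xN; rewrite ffunE; apply: (coef_graded uP) => //.
  exact/(gaut_graded fG)/(u_graded uP).
by case: fG => fM _; rewrite -[X in _ * X]iota1 -gaut_iota -fM iota1 (ue uP).
Qed.

Lemma chi_character : character_on (stab_group j) (chi f).
Proof.
have [fM [f1 _]] := fG; have chi1 : chi f 1%g = 1.
  apply: (iotau_inj uP (group1 (stab_group j))); rewrite -gaut_u //.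
  have [|c hc] := iota_onto _ (ue uP (group1 (stab_group j))).
    exact/graded1/(u_graded uP)/group1.
  by rewrite -hc gaut_iota iota1 -ce iotae.
split=> // [x y xN yN|x xN]; last by rewrite ffunE coef_notin.
have fw : f (u x * u y) = iota (chi f (x * y)%g) * (u x * u y).
  by rewrite uM_coef // fM gaut_iota gaut_u ?groupM // iotaCA.
apply: iota_inj; rewrite -[LHS]iotae -[RHS]iotae.
have <- : u x * u y * (v y * v x) = e.
  by rewrite mulrA -[_ * v y]mulrA (uv uP) // (ue uP) // (uv uP).
rewrite [LHS]mulrA -fw fM !gaut_u // iotaCA -[iota _ * u x * _]mulrA [iota _ * (iota _ * _)]mulrA -iotaM.
by rewrite -[LHS]mulrA [chi f y * _]mulrC.
Qed.

End Fixing.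

(** Equivariance and [block_faithful] reduce equality to the block, where the values on the [u x]
    decide. *)
Lemma chi_inj f f' : is_GAut act f -> is_GAut act f' -> f j = j -> f' j = j ->
  chi f = chi f' -> f = f'.
Proof.
move=> fG fG' fj fj' hchi; apply/lfunP => a; apply/eqP; rewrite -subr_eq0; apply/eqP.
apply: block_faithful => t.
have fe h (hG : is_GAut act h) (hj : h j = j) : act t e * h a = act t (h (act t^-1%g a * e)).
  have [hM [_ [_ hact]]] := hG; have := gaut_iota hG hj 1; rewrite iota1 => he.
  by rewrite -hact galgM galgVK hM hact he (central_act t ce).
rewrite mulrBr !fe // -linearB; apply/eqP; rewrite galg_eq0 subr_eq0; apply/eqP.
rewrite (coefP uP) !linear_sum; apply: eq_bigr => x xN /=.
case: (fG) (fG') => fM _ [fM' _].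
by rewrite fM fM' !gaut_iota // !gaut_u // hchi.
Qed.

Variable s : seq 'End(A).
Hypotheses (us : uniq s) (ss : size s = #|gT|) (sP : forall f : 'End(A), f \in s <-> is_GAut act f).
Hypothesis gaut_orbit : forall f, is_GAut act f -> exists t, f j = act t j.

Let S1 := [seq f : 'End(A) <- s | f j == j].

Lemma S1P f : f \in S1 -> is_GAut act f /\ f j = j.
Proof. by rewrite mem_filter => /andP[/eqP fj /sP]. Qed.

Lemma chi_uniq : uniq (map chi S1).
Proof.
rewrite map_inj_in_uniq ?filter_uniq // => f f' /S1P[fG fj] /S1P[fG' fj'].
exact: chi_inj.
Qed.

Lemma chi_char c : c \in map chi S1 -> character_on (stab_group j) c.
Proof. by case/mapP => f /S1P[fG fj] ->; apply: chi_character. Qed.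

(** A nonempty fibre injects into [S1] by composition with the inverse of one of its members
    [f0]. *)
Lemma count_fiber t : (count (fun f : 'End(A) => f j == act t j) s <= size S1)%N.
Proof.
rewrite -size_filter; set r := filter _ s.
case: {2}r (erefl r) => [->//|f0 r' er].
have /[!mem_filter]/andP[/eqP f0j /sP f0G] : f0 \in r by rewrite er mem_head.
have [f0M [f01 [[h f0K hK] f0act]]] := f0G.
have f0ker : lker f0 == 0%VS by apply/lker0P; apply: can_inj f0K.
have iK : cancel f0 (f0^-1)%VF := lker0_lfunK f0ker.
have Ki : cancel (f0^-1)%VF f0 := lker0_lfunVK f0ker.
rewrite -(size_map (comp_lfun f0^-1%VF) r); apply: uniq_leq_size.
  rewrite map_inj_in_uniq ?filter_uniq // => f f' _ _ ff'; apply/lfunP => a.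
  by apply: (can_inj Ki); have /lfunP/(_ a) := ff'; rewrite !comp_lfunE.
move=> _ /mapP[f + ->]; rewrite !mem_filter => /andP[/eqP fj /sP fG].
rewrite comp_lfunE fj -f0j iK eqxx /=; apply/sP.
have [fM [f1 [[f' fK f'K] fact]]] := fG.
split=> [a b|]; first by rewrite !comp_lfunE fM -{1}[f a]Ki -{1}[f b]Ki -f0M iK.
split; first by rewrite comp_lfunE f1 -f01 iK.
split=> [|g a]; last by rewrite !comp_lfunE fact -{1}[f a]Ki -f0act iK.
by exists (f' \o f0) => a; rewrite comp_lfunE /= ?Ki ?fK ?f'K ?iK.
Qed.

(** Double count: for each [f] the [t] with [f j = act t j] form a left coset of N. *)
Lemma sum_fibers :
  \sum_(t : gT) count (fun f : 'End(A) => f j == act t j) s = (#|gT| * #|N|)%N.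
Proof.
under eq_bigr do rewrite -sum1_count big_mkcond.
rewrite exchange_big -ss big_seq (eq_bigr (fun=> #|N|)) /=.
  by rewrite -big_seq big_const_seq count_predT iter_addn_0 mulnC.
move=> f /sP /gaut_orbit[t0 ft0]; rewrite -big_mkcond sum1_card.
rewrite -(card_lcoset N t0); apply: eq_card => t.
transitivity (act t0 j == act t j); first by rewrite -ft0.
rewrite mem_lcoset inE galg_actM.
by apply/eqP/eqP => [<-|h]; rewrite ?galgK // -{1}h galgVK.
Qed.

(** Each fibre has at most [#|N|] elements by [character_count], and these bounds add up to the
    total of [sum_fibers], so all of them are attained. *)
Lemma count_fiberE t : count (fun f : 'End(A) => f j == act t j) s = #|N|.
Proof.
have cle t' : (count (fun f : 'End(A) => f j == act t' j) s <= #|N|)%N.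
  apply: leq_trans (count_fiber t') _; rewrite -(size_map chi).
  by case: (character_count chi_uniq chi_char).
have [_] := leqif_sum (fun t (_ : true) => leqif_eq (cle t)).
rewrite sum_fibers sum_nat_const eqxx => /esym/forallP/(_ t).
by move/eqP.
Qed.

Lemma gaut_transitive t : exists2 f, is_GAut act f & f j = act t j.
Proof.
have : has (fun f : 'End(A) => f j == act t j) s.
  by rewrite has_count count_fiberE cardG_gt0.
by case/hasP => f /sP fG /eqP; exists f.
Qed.

Lemma chi_separates x y : x \in N -> y \in N ->
  (forall f, is_GAut act f -> f j = j -> chi f x = chi f y) -> x = y.
Proof.
move=> xN yN h; have [_ sep] := character_count chi_uniq chi_char.
apply: sep => // [|c /mapP[f /S1P[fG fj] ->]]; last exact: h.
by rewrite size_map size_filter -(count_fiberE 1%g); apply: eq_count => f; rewrite galg_act1.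
Qed.

End Automorphisms.

(** * Choice of units, orbit of the block and normality of stabilisers *)

Lemma eZ_domain z w : central z -> z * e = z -> w * e = w -> z * w = 0 -> z = 0 \/ w = 0.
Proof.
move=> hz ze we zw; have [->|z0] := eqVneq z 0; first by left.
right; have [|y hy zy] := eZ_field hz; first by rewrite ze.
by rewrite -we -zy mulrA hz zw mul0r.
Qed.

Lemma unit_choice : exists u v : gT -> A, forall x, x \in N -> unit_at x (u x) (v x).
Proof.
have /boolp.choice[p pP] : forall x, exists p : A * A, x \in N -> unit_at x p.1 p.2.
  move=> x; have [xN|_] := boolP (x \in N); last by exists 0.
  by have [u [v uvP]] := unit_at_exists xN; exists (u, v).
by exists (fun x => (p x).1), (fun x => (p x).2).
Qed.

Lemma unit_at_scale x u v c : c != 0 -> unit_at x u v ->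
  unit_at x (iota c * u) (iota c^-1 * v).
Proof.
move=> c0 [gu ue' ve' uv' vu']; split.
- rewrite -[iota c * _]iota_central; apply: gradedMz => //; exact: iota_central.
- by rewrite -mulrA ue'.
- by rewrite -mulrA ve'.
- by rewrite -mulrA iotaCA uv' mulrA -iotaM mulfV // iota1 ee.
by rewrite -mulrA iotaCA vu' mulrA -iotaM mulVf // iota1 ee.
Qed.

(** By [block_faithful] some [act t e * f e] is nonzero. Both factors are images of [e] under
    automorphisms, so minimality of [e], transported by their inverses, identifies them. *)
Lemma gaut_block_orbit f : is_GAut act f -> exists t, f e = act t e.
Proof.
move=> fG; have [fM [f1 [[h fK hK] fact]]] := fG.
have fe0 : f e != 0.
  by apply: contraNneq e_neq0 => fe; apply/eqP; apply: (can_inj fK); rewrite fe linear0.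
have [t te] : exists t, act t e * f e != 0.
  apply/existsP; apply: contraNT fe0 => /existsPn nt; apply/eqP/block_faithful => t.
  by apply/eqP; have := nt t; rewrite negbK.
have hM a b : h (a * b) = h a * h b by rewrite -{1}[a]hK -{1}[b]hK -fM fK.
have hc (a : A) : central a -> central (h a) by move=> ha b; rewrite -[b]fK -!hM ha.
exists t; have h1 : h (act t e) * e = e.
  apply: idem_block; first by apply: hc; exact: central_act.
    by rewrite -hM -galgM ee.
  by apply: contraNneq te => h0; rewrite -[act t e]hK -fM h0 linear0.
have h2 : act t^-1%g (f e) * e = e.
  apply: idem_block; first by apply: central_act; exact: gaut_central.
    by rewrite -galgM -fM ee.
  rewrite -(galg_eq0 t) galgM galgVK; apply: contraNneq te => <-.
  by rewrite (gaut_central fG ce).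
rewrite -[RHS]/(act t e) -{2}h2 galgM galgVK -{1}h1 fM hK.
by rewrite (gaut_central fG ce).
Qed.

(** As [f] commutes with the action, whatever fixes [w] also fixes [f w = act t w]. *)
Lemma stab_normal (w : A) : (forall t, exists2 f, is_GAut act f & f w = act t w) ->
  (stab_group w <| [set: gT])%g.
Proof.
move=> tr; rewrite /normal subsetT; apply/subsetP => t _.
rewrite inE; apply/subsetP => _ /imsetP[x /stabP xw ->].
have [f [fM [_ [_ fact]]] fw] := tr t.
by apply/stabP; rewrite /conjg !galg_actM -fw -fact xw fw galgK.
Qed.

(** * Invariance of the cohomology class under conjugation *)

Section Conjugation.
Variables (u v : gT -> A) (bar : gT -> F -> F) (sigma gamma : gT -> gT -> F).
Hypothesis uP : forall x, x \in N -> unit_at x (u x) (v x).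
Hypothesis act_iota : forall s a, s \in S -> act s (iota a) = iota (bar s a).
Hypothesis u1 : u 1%g = e.
Hypothesis uM : forall x y, x \in N -> y \in N ->
  u x * u y = iota (sigma x y) * u (x * y)%g.
Hypothesis uact : forall s x, s \in S -> x \in N ->
  act s (u x) = iota (gamma s x) * u (s * x * s^-1)%g.
Hypothesis NG : (stab_group j <| [set: gT])%g.
Hypothesis SG : (stab_group e <| [set: gT])%g.

Lemma conj_in (w : A) t x : (stab_group w <| [set: gT])%g -> x \in stab_group w ->
  (t * x * t^-1)%g \in stab_group w.
Proof.
move=> wG xw; have /normsP/(_ t^-1%g (in_setT _)) := normal_norm wG.
by move/setP/(_ (t * x * t^-1)%g); rewrite mem_conjg /conjg !invgK !mulgA mulVg mul1g mulgKV xw => <-.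
Qed.

(** The composite [phi] of [f] and [act t] fixes eZ(A) and conjugates degrees by [t], so it sends
    [u x] to a multiple [tau' x] of the unit at [t * x * t^-1]. Applying it to the relations between
    the units yields the claim, with the inverse of [tau'] as cochain. *)
Lemma conj_cohom f t : is_GAut act f -> f j = act t^-1%g j ->
  cohom_conj bar (stab_group j) (stab_group e) sigma gamma (fun a => a != 0) t.
Proof.
move=> fG fj; have [fM [f1 [fb fact]]] := fG.
pose phi a := act t (f a).
have phiM a b : phi (a * b) = phi a * phi b by rewrite /phi fM galgM.
have phi_iota a : phi (iota a) = iota a.
  by rewrite /phi iotaE !linearD !linearZ /= fM galgM fj galgVK.
have phi_act s a : phi (act s a) = act (t * s * t^-1)%g (phi a).
  by rewrite /phi fact !galg_actM galgK.
have phi_u x : x \in N -> exists c, phi (u x) = iota c * u (t * x * t^-1)%g.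
  move=> xN; have xtN : (t * x * t^-1)%g \in N by apply: (conj_in _ NG).
  apply: (graded_unitE (uP xtN)); first exact/graded_act/(gaut_graded fG)/(u_graded uP).
  by rewrite -iota1 -[iota 1]phi_iota -phiM iota1 (ue uP).
have /boolp.choice[tau' tauP] : forall x, exists c, x \in N ->
    phi (u x) = iota c * u (t * x * t^-1)%g.
  move=> x; have [xN|_] := boolP (x \in N); last by exists 0.
  by have [c ec] := phi_u x xN; exists c.
have tau'0 x : x \in N -> tau' x != 0.
  move=> xN; apply: contraNneq (u_neq0 uP xN) => t0; have := tauP x xN; rewrite t0 iota0 mul0r /phi => /eqP.
  rewrite galg_eq0; case: fb => h fK _ /eqP f0.
  by apply/eqP; apply: (can_inj fK); rewrite f0 linear0.
have tau'1 : tau' 1%g = 1.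
  apply: (iotau_inj uP (group1 (stab_group j))).
  have := tauP 1%g (group1 (stab_group j)); rewrite mulg1 mulgV => <-.
  by rewrite iota1 u1 -iota1 phi_iota iota1 ee.
exists (fun x => (tau' x)^-1); split; first by rewrite tau'1 invr1.
split=> [x xN|]; first by rewrite invr_eq0 tau'0.
have bar_conj s a : s \in S -> bar (t * s * t^-1)%g a = bar s a.
  move=> sS; apply: iota_inj; rewrite -!act_iota //; last exact: (conj_in _ SG).
  by rewrite -[in LHS](phi_iota a) -phi_act act_iota // phi_iota.
split=> [x y xN yN|s x sS xN].
  have := congr1 phi (uM xN yN); rewrite !phiM phi_iota !tauP ?groupM //.
  have -> : (t * (x * y) * t^-1 = t * x * t^-1 * (t * y * t^-1))%g.
    by rewrite !mulgA mulgKV.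
  rewrite iotaCA -[_ * u _ * u _]mulrA uM ?(conj_in _ NG) // !mulrA -!iotaM.
  move/(iotau_inj uP (groupM (conj_in t NG xN) (conj_in t NG yN))) => h.
  have := tau'0 _ xN; have := tau'0 _ yN; have := tau'0 _ (groupM xN yN) => n1 n2 n3.
  apply: (mulfI (mulf_neq0 n2 n3)); rewrite h invrK.
  by rewrite [RHS]mulrC -!mulrA; congr (_ * _); rewrite mulrA [RHS]mulrCA -invfM; rewrite [tau' x * _]mulrC mulVf ?mulr1 ?mulf_neq0.
have xsN := stabJ sS xN.
have := phi_act s (u x); rewrite uact // phiM phi_iota !tauP //.
have tsS := conj_in t SG sS.
rewrite galgM act_iota // uact ?(conj_in _ NG) // bar_conj // !mulrA -!iotaM.
have -> : (t * (s * x * s^-1) * t^-1 = t * s * t^-1 * (t * x * t^-1) * (t * s * t^-1)^-1)%g.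
  by rewrite !invMg invgK !mulgA !mulgKV.
have xtN : (t * s * t^-1 * (t * x * t^-1) * (t * s * t^-1)^-1)%g \in N.
  exact: (stabJ tsS (conj_in t NG xN)).
move/(iotau_inj uP xtN) => h.
have bar_inv : bar s (tau' x) * bar s (tau' x)^-1 = 1.
  apply: iota_inj; rewrite iotaM -!act_iota // -galgM -iotaM mulfV ?tau'0 // iota1.
  exact/stabP.
by rewrite invrK mulrAC h mulrAC bar_inv mul1r.
Qed.

(** With [s = sigma x y] and [t = sigma y x], the values of the squares of units give
    [(s * t) ^+ 2 = 1], and centrality of [u x * u x] gives [s ^+ 2 = t ^+ 2]. *)
Lemma sigma_order4 x y : x \in N -> y \in N -> (x * y = y * x)%g ->
  (forall z, z \in N -> u z * u z = e \/ u z * u z = - e) ->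
  sigma x y ^+ 4 = 1.
Proof.
move=> xN yN xy u2.
have {}u2 z : z \in N -> exists2 c, c * c = 1 & u z * u z = iota c.
  case/u2 => ->; first by exists 1; rewrite ?mulr1 ?iota1.
  by exists (-1); rewrite ?mulrNN ?mulr1 ?iotaN ?iota1.
have [a a2 ua] := u2 x xN; have [b b2 ub] := u2 y yN.
have [c c2 uc] := u2 _ (groupM xN yN).
set s := sigma x y; set t := sigma y x.
have hs : u x * u y = iota s * u (x * y)%g by rewrite uM.
have ht : u y * u x = iota t * u (x * y)%g by rewrite uM // xy.
have st2 : (s * t) ^+ 2 = 1.
  have : u x * u y * (u y * u x) = iota (b * a).
    by rewrite mulrA -[u x * _ * _]mulrA ub iota_central -mulrA ua iotaM.
  rewrite hs ht iotaCA -mulrA uc -!iotaM => /iota_inj h.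
  have -> : s * t = b * a * c by rewrite -h -!mulrA c2 mulr1 mulrC.
  by rewrite expr2 mulrACA c2 mulr1 mulrACA b2 a2 mulr1.
have comm : iota s * (u y * u x) = iota t * (u x * u y).
  by rewrite hs ht !mulrA -!iotaM mulrC.
have s2t2 : s ^+ 2 = t ^+ 2.
  have h1 : iota (s * s) * (u y * u x * u x) = iota (s * s * a) * u y.
    by rewrite -mulrA ua iota_central mulrA -iotaM.
  have h2 : iota (s * s) * (u y * u x * u x) = iota (t * t * a) * u y.
    rewrite iotaM -mulrA [iota s * (_ * u x)]mulrA comm -!mulrA iotaCA.
    rewrite -[iota s * _]iotaCA comm iotaCA.
    by rewrite [u x * (u x * _)]mulrA ua !mulrA -!iotaM.
  have := h1; rewrite h2 => /(iotau_inj uP yN) h.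
  have a0 : a != 0 by apply: contra_eq_neq a2 => ->; rewrite mulr0 eq_sym oner_eq0.
  by rewrite !expr2; apply: (mulIf a0); rewrite h.
by rewrite -[4%N]/(2 * 2)%N exprM expr2 {2}s2t2 -exprMn.
Qed.

End Conjugation.

(** * Torsor data from transitivity and separation by characters *)

Section Torsor.
Hypothesis tr : forall t, exists2 f, is_GAut act f & f j = act t j.
Variables (u0 v0 : gT -> A).
Hypothesis u0P : forall x, x \in N -> unit_at x (u0 x) (v0 x).
Hypothesis sep : forall x y, x \in N -> y \in N ->
  (forall f, is_GAut act f -> f j = j -> chi u0 v0 f x = chi u0 v0 f y) -> x = y.

Lemma stab_j_normal : (stab_group j <| [set: gT])%g.
Proof. exact: stab_normal tr. Qed.

Lemma stab_e_normal : (stab_group e <| [set: gT])%g.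
Proof.
apply: stab_normal => t; have [f fG fj] := tr t; exists f => //.
have [fM _] := fG.
by rewrite -iota1 iotaE !linearD !linearZ /= fM galgM fj.
Qed.

Lemma chi_char_expn f x n : is_GAut act f -> f j = j -> x \in N ->
  chi u0 v0 f (x ^+ n)%g = chi u0 v0 f x ^+ n.
Proof.
move=> fG fj xN; have [c1 cM _] := chi_character u0P fG fj.
elim: n => [|n IHn]; first by rewrite expg0 expr0.
by rewrite expgS exprS cM ?groupX // IHn.
Qed.

Lemma chi_char_finite f x : is_GAut act f -> f j = j -> x \in N ->
  chi u0 v0 f x ^+ #|N| = 1.
Proof.
move=> fG fj xN; rewrite -chi_char_expn //.
by rewrite (expg_cardG (G := stab_group j)) //; case: (chi_character u0P fG fj).
Qed.

Lemma involutive_comm x y : (forall z, z \in N -> z * z = 1)%g -> x \in N -> y \in N ->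
  (x * y = y * x)%g.
Proof.
move=> N2 xN yN; have inv z : z \in N -> (z^-1 = z)%g.
  by move=> zN; apply/eqP; rewrite eq_invg_mul N2.
by rewrite -[LHS]inv ?groupM // invMg !inv.
Qed.

Lemma stab_abelem : (forall z, z \in N -> z * z = 1)%g -> (2.-abelem (stab_group j))%g.
Proof.
move=> N2; rewrite abelemE //; apply/andP; split.
  by apply/centsP => x xN y yN; apply: involutive_comm.
by apply/exponentP => x xN; rewrite expgS expg1 N2.
Qed.

(** * Blocks with centre k *)

Section Real.
Hypothesis SN : stab e = stab j.
Hypothesis fin_sqr : forall (c : F) n, (0 < n)%N -> c ^+ n = 1 -> c * c = 1.
Hypothesis sqrtF : forall c : F, c != 0 ->
  exists2 d, d != 0 & d * d * c = 1 \/ d * d * c = -1.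

(** Character values are roots of unity in [F], so of square 1, and no character separates [z * z]
    from 1. *)
Lemma real_stab_sqr z : z \in N -> (z * z = 1)%g.
Proof.
move=> zN; apply: sep; rewrite ?groupM ?(group1 (stab_group j)) // => f fG fj.
have [c1 cM _] := chi_character u0P fG fj.
by rewrite c1 cM // (fin_sqr (cardG_gt0 (stab_group j))) ?chi_char_finite.
Qed.

(** The square of [u0 x] has degree 1, hence is a nonzero element of eZ(A), which [sqrtF] rescales
    to a sign. The unit at the identity is chosen to be [e], so that the cocycle is normalised. *)
Lemma real_units : exists u v : gT -> A,
  [/\ forall x, x \in N -> unit_at x (u x) (v x), u 1%g = e &
      forall x, x \in N -> u x * u x = e \/ u x * u x = - e].
Proof.
have /boolp.choice[p pP] : forall x, exists p : A * A, x \in N ->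
    [/\ unit_at x p.1 p.2, x = 1%g -> p.1 = e & p.1 * p.1 = e \/ p.1 * p.1 = - e].
  move=> x; have [xN|_] := boolP (x \in N); last by exists 0.
  have [->|x1] := eqVneq x 1%g.
    exists (e, e) => _; split=> //=; last by left.
    by split=> //; apply/graded1.
  have hc : central (u0 x * u0 x).
    by apply/graded1; rewrite -(real_stab_sqr xN); apply: gradedM; apply: (u_graded u0P).
  have [|c hcc] := iota_onto hc; first by rewrite -mulrA (ue u0P).
  have c0 : c != 0.
    rewrite -iota_eq0 hcc; apply: contraNneq (u_neq0 u0P xN) => h.
    have [_ _ _ _ vu] := u0P xN.
    by rewrite -(ue u0P xN) ce -vu -mulrA h mulr0.
  have [d d0 hd] := sqrtF c0.
  exists (iota d * u0 x, iota d^-1 * v0 x) => _; split=> //=.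
  - by apply: unit_at_scale => //; apply: u0P.
  - by move/eqP; rewrite (negPf x1).
  have h : iota d * u0 x * (iota d * u0 x) = iota (d * d * c).
    by rewrite iotaCA -mulrA -hcc mulrA -!iotaM.
  by case: hd => hd; [left | right]; apply: (etrans h); rewrite hd ?iotaN iota1.
exists (fun x => (p x).1), (fun x => (p x).2); split.
- by move=> x /pP[].
- by case: (pP 1%g) => [|_ ->//]; apply: group1 (stab_group j).
- by move=> x /pP[].
Qed.

Lemma real_case (inj : k -> F) : (forall c, iota (inj c) = c *: e) ->
  exists (sigma : gT -> gT -> F),
  let gamma x y := sigma x y * sigma (x * y)%g x^-1%g / sigma x x^-1%g in
  [/\ forall x y, x \in N -> y \in N -> sigma x y = 1 \/ sigma x y = -1,
      Z2S_n (fun=> id) (stab_group j) (stab_group j) sigma gamma,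
      nondeg (stab_group j) sigma,
      forall g, exists tau : gT -> F, [/\ tau 1%g = 1,
         forall x, x \in N -> tau x = 1 \/ tau x = -1 &
         forall x y, x \in N -> y \in N ->
           sigma (g * x * g^-1)%g (g * y * g^-1)%g
           = sigma x y * (tau x * tau y / tau (x * y)%g)]
    & iso_Ind inj (fun=> id) (stab_group j) (stab_group j) sigma gamma act].
Proof.
move=> iota_inj'; have [u [v [uP u1 u2]]] := real_units.
have N2 := real_stab_sqr.
have pm1 (c : F) : c * c = 1 -> c = 1 \/ c = -1.
  by move/eqP; rewrite -expr2 sqrf_eq1 => /orP[]/eqP; [left | right].
pose sigma x y := coef v (u x * u y) (x * y)%g.
have uM x y : x \in N -> y \in N -> u x * u y = iota (sigma x y) * u (x * y)%g.
  by move=> xN yN; rewrite {1}(uM_coef uP xN yN).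
clearbody sigma; exists sigma => gamma.
(* The actual coefficient of the action; as S = N, the last condition of [Z2S_n] identifies it with
   the prescribed [gamma]. *)
pose gamma0 s x := coef v (act s (u x)) (s * x * s^-1)%g.
have SgN : stab_group e = stab_group j by apply: val_inj.
have act_iota s a : s \in S -> act s (iota a) = iota a.
  by rewrite SN; apply: iota_fix.
have uact0 s x : s \in S -> x \in N -> act s (u x) = iota (gamma0 s x) * u (s * x * s^-1)%g.
  move=> sS xN; apply: (coef_graded uP); first exact: stabJ.
    exact/graded_act/(u_graded uP).
  by rewrite -{1}(stabP _ _ sS) -galgM (ue uP).
have Z0 := @twisted_Z2S_n u v uP (fun=> id) sigma gamma0 act_iota u1 uM uact0.
have gammaE x y : x \in N -> y \in N -> gamma0 x y = gamma x y.
  by case: Z0 => _ [_ [_ [_ [_ [_ [_]]]]]]; apply.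
have uact s x : s \in S -> x \in N -> act s (u x) = iota (gamma s x) * u (s * x * s^-1)%g.
  by move=> sS xN; rewrite uact0 // gammaE // -SN.
have Z1 := @twisted_Z2S_n u v uP (fun=> id) sigma gamma act_iota u1 uM uact.
have I1 := @twisted_iso u v uP inj (fun=> id) sigma gamma iota_inj' act_iota u1 uM uact.
rewrite SgN in Z1 I1.
have sig1 x y : x \in N -> y \in N -> sigma x y = 1 \/ sigma x y = -1.
  move=> xN yN; apply: pm1; apply: (@fin_sqr _ 4) => //.
  by apply: (sigma_order4 uP uM) => //; apply: involutive_comm.
split=> //.
- move=> x xN h; apply: (unit_central uP xN) => y yN.
  have xy := involutive_comm N2 xN yN.
  by rewrite !uM // h // xy.
move=> g; have [f fG fj] := tr g^-1%g.
have [tau [tau1 [tau0 [tauE _]]]] :=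
  conj_cohom uP act_iota u1 uM uact stab_j_normal stab_e_normal fG fj.
exists tau; split=> // x xN; apply: pm1.
(* As [x * x = 1], the coboundary at [(x, x)] is the square of [tau x]. It is a quotient of signs,
   so [tau x ^+ 4 = 1]. *)
have := tauE x x xN xN; rewrite N2 // tau1 divr1 => h.
apply: (@fin_sqr _ 4) => //; rewrite -[4%N]/(2 * 2)%N exprM expr2.
have xgN := conj_in g stab_j_normal xN.
have /(congr1 (fun c => c ^+ 2)) := h; rewrite exprMn !expr2.
by case: (sig1 _ _ xgN xgN) => ->; case: (sig1 _ _ xN xN) => ->;
   rewrite ?mulrNN ?mulr1 ?mul1r => <-.
Qed.

End Real.

(** * Blocks with centre k(i) *)

Section Complex.
Variables (conjF : {rmorphism F -> F}) (s0 : gT) (i0 : F).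
Hypotheses (s0S : s0 \in S) (s0j : act s0 j = - j).
Hypothesis actN_j : forall s, s \in S -> s \notin N -> act s j = - j.
Hypothesis conj_iota : forall a, act s0 (iota a) = iota (conjF a).
Hypothesis conj_norm : forall c n, (0 < n)%N -> c ^+ n = 1 -> conjF c * c = 1.
Hypothesis real_sqr : forall c n, (0 < n)%N -> conjF c = c -> c ^+ n = 1 -> c * c = 1.
Hypothesis sqrtF : forall c : F, exists d, d * d = c.
Hypotheses (i0_sqr : i0 * i0 = -1) (i0_conj : conjF i0 = - i0).

Let bar s a := if s \notin N then conjF a else a.

Lemma opp_j_iota (f : 'End(A)) a : (forall b c, f (b * c) = f b * f c) -> f j = - j ->
  f (iota a) = iota (conjF a).
Proof.
move=> fM fj; rewrite -conj_iota !iotaE !linearD !linearZ /= fM galgM fj s0j.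
by rewrite !mulrNN.
Qed.

Lemma act_iota_bar s a : s \in S -> act s (iota a) = iota (bar s a).
Proof.
move=> sS; rewrite /bar; have [sN|sN] := boolP (s \in N); first exact: iota_fix.
by apply: opp_j_iota; [exact: galgM | exact: actN_j].
Qed.

Lemma complex_stab_comm x y : x \in N -> y \in N -> (x * y = y * x)%g.
Proof.
move=> xN yN; apply: sep; rewrite ?(groupM (G := stab_group j)) // => f fG fj.
by have [_ cM _] := chi_character u0P fG fj; rewrite !cM // mulrC.
Qed.

(** Since [s] conjugates eZ(A) and commutes with [f], the character value at [s * x * s^-1] is the
    conjugate of the value at [x]; for a root of unity this is the inverse. *)
Lemma complex_stab_inv s x : s \in S -> s \notin N -> x \in N -> (s * x * s^-1 * x = 1)%g.
Proof.
move=> sS sN xN; have xsN := stabJ sS xN.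
have xxN : (s * x * s^-1 * x)%g \in N by apply: (groupM (G := stab_group j)).
apply: (sep xxN (group1 (stab_group j))) => f fG fj.
have [c1 cM _] := chi_character u0P fG fj; rewrite cM // c1.
suff -> : chi u0 v0 f (s * x * s^-1)%g = conjF (chi u0 v0 f x).
  by apply: (conj_norm (cardG_gt0 (stab_group j))); apply: chi_char_finite.
have [c ec] : exists c, act s (u0 x) = iota c * u0 (s * x * s^-1)%g.
  apply: (graded_unitE (u0P xsN)); first exact/graded_act/(u_graded u0P).
  by rewrite -(stabP _ _ sS) -galgM (ue u0P).
have c0 : c != 0.
  rewrite -iota_eq0; apply: contraNneq (u_neq0 u0P xN) => h.
  by rewrite -(galg_eq0 s) ec h mul0r.
have [fM [_ [_ fact]]] := fG; have := fact s (u0 x).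
rewrite ec fM (gaut_iota fG fj) !(gaut_u u0P fG fj) // galgM act_iota_bar // ec /bar sN.
rewrite !mulrA -!iotaM => /(iotau_inj u0P xsN).
by rewrite [RHS]mulrC => /(mulfI c0).
Qed.

(* An automorphism conjugating eZ shows that the commutator pairing of N is
   real, hence of order 2; being non-degenerate it forces N to have exponent 2. *)
Lemma complex_stab_sqr x : x \in N -> (x * x = 1)%g.
Proof.
move=> xN; have xxN : (x * x)%g \in N by apply: (groupM (G := stab_group j)).
apply: (unit_central u0P xxN) => y yN.
have [f fG fj0] := tr s0; have [fM [_ [_ fact]]] := fG.
have fj : f j = - j by rewrite fj0.
have fiota a : f (iota a) = iota (conjF a) by apply: opp_j_iota.
have fe : f e = e by rewrite -iota1 fiota rmorph1.
have fu z : z \in N -> exists2 c, c != 0 & f (u0 z) = iota c * u0 z.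
  move=> zN; have [|c ec] := graded_unitE (u0P zN) (gaut_graded fG (u_graded u0P zN)).
    by rewrite -{1}fe -fM (ue u0P).
  exists c => //; rewrite -iota_eq0; apply: contraNneq (u_neq0 u0P zN) => h.
  have [_ [_ [[f' fK _] _]]] := fG.
  by apply/eqP; apply: (can_inj fK); rewrite ec h mul0r linear0.
have [a ea] : exists a, act x (u0 y) = iota a * u0 y.
  apply: (graded_unitE (u0P yN)).
    have := graded_act x (u_graded u0P yN).
    by rewrite (complex_stab_comm xN yN) mulgK.
  by rewrite -(stabP _ _ (subsetP sub_stab x xN)) -galgM (ue u0P).
have a_real : conjF a = a.
  have [c c0 ec] := fu y yN.
  have := fact x (u0 y); rewrite ea fM fiota ec galgM (iota_fix _ xN) ea.
  rewrite !mulrA -!iotaM => /(iotau_inj u0P yN).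
  by rewrite [RHS]mulrC => /(mulIf c0).
have act_expn n : act (x ^+ n)%g (u0 y) = iota (a ^+ n) * u0 y.
  elim: n => [|n IHn]; first by rewrite expg0 galg_act1 expr0 iota1 -ce (ue u0P).
  by rewrite expgSr galg_actM ea galgM (iota_fix _ (groupX (G := stab_group j) n xN)) IHn mulrA -iotaM exprS.
have a_fin : a ^+ #|N| = 1.
  apply: (iotau_inj u0P yN); rewrite -act_expn (expg_cardG (G := stab_group j)) //.
  by rewrite galg_act1 iota1 -ce (ue u0P).
have a2 := real_sqr (cardG_gt0 (stab_group j)) a_real a_fin.
rewrite -(u_graded u0P xxN) galg_actM ea galgM (iota_fix _ xN) ea mulrA -iotaM a2 iota1.
by rewrite -ce (ue u0P).
Qed.

Lemma complex_stab_cent s x : s \in S -> x \in N -> (s * x * s^-1 = x)%g.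
Proof.
move=> sS xN; have [sN|sN] := boolP (s \in N).
  by rewrite (complex_stab_comm sN xN) mulgK.
apply: (mulIg x); rewrite complex_stab_inv //.
by rewrite complex_stab_sqr.
Qed.

(** A square root in [F] gives [w] with [w * w = e], and [s0] multiplies [w] by a sign. If the sign
    is -1, then [i0 * w] is fixed by [s0], because [i0] changes sign too, and has square [- e]. *)
Lemma complex_units : exists u v : gT -> A,
  [/\ forall x, x \in N -> unit_at x (u x) (v x), u 1%g = e,
      forall x, x \in N -> u x * u x = e \/ u x * u x = - e &
      forall x, x \in N -> act s0 (u x) = u x].
Proof.
have /boolp.choice[p pP] : forall x, exists p : A * A, x \in N ->
    [/\ unit_at x p.1 p.2, x = 1%g -> p.1 = e, p.1 * p.1 = e \/ p.1 * p.1 = - e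
      & act s0 p.1 = p.1].
  move=> x; have [xN|_] := boolP (x \in N); last by exists 0.
  have [->|x1] := eqVneq x 1%g.
    exists (e, e) => _; split=> //=; [by split=> //; apply/graded1 | by left | exact/stabP].
  have hc : central (u0 x * u0 x).
    by apply/graded1; rewrite -(complex_stab_sqr xN); apply: gradedM; apply: (u_graded u0P).
  have [|c hcc] := iota_onto hc; first by rewrite -mulrA (ue u0P).
  have c0 : c != 0.
    rewrite -iota_eq0 hcc; apply: contraNneq (u_neq0 u0P xN) => h.
    have [_ _ _ _ vu] := u0P xN.
    by rewrite -(ue u0P xN) ce -vu -mulrA h mulr0.
  have [d hd] := sqrtF c^-1.
  have d0 : d != 0 by apply: contra_eq_neq hd => ->; rewrite mul0r eq_sym invr_eq0.
  pose w : A := iota d * u0 x.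
  have wP : unit_at x w (iota d^-1 * v0 x) by apply: unit_at_scale => //; apply: u0P.
  have w2 : w * w = e.
    by rewrite /w iotaCA -mulrA -hcc mulrA -!iotaM hd mulVf // iota1.
  have [b eb] : exists b, act s0 w = iota b * w.
    case: (wP) => gw we _ _ _; apply: (graded_unitE wP).
      by have := graded_act s0 gw; rewrite complex_stab_cent.
    by rewrite -(stabP _ _ s0S) -galgM we.
  have b2 : b * b = 1.
    have := congr1 (act s0) w2.
    rewrite galgM eb iotaCA -[iota b * w * w]mulrA w2 (stabP _ _ s0S) mulrA -iotaM iotae => h.
    by apply: iota_inj; rewrite h iota1.
  have /orP[/eqP b1|/eqP b1] : (b == 1) || (b == -1) by rewrite -sqrf_eq1 expr2 b2.
    exists (w, iota d^-1 * v0 x) => _; split=> //=; first by move/eqP; rewrite (negPf x1).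
      by left.
    by have [_ we _ _ _] := wP; rewrite eb b1 iota1 -ce.
  have i00 : i0 != 0 by apply: contra_eq_neq i0_sqr => ->; rewrite mul0r eq_sym oppr_eq0 oner_eq0.
  exists (iota i0 * w, iota i0^-1 * (iota d^-1 * v0 x)) => _; split=> //=.
  - exact: unit_at_scale.
  - by move/eqP; rewrite (negPf x1).
  - right; have h : iota i0 * w * (iota i0 * w) = iota (i0 * i0) * (w * w).
      by rewrite iotaCA -mulrA mulrA -iotaM.
    by apply: (etrans h); rewrite w2 i0_sqr iotaN iota1 mulNr ee.
  rewrite galgM conj_iota eb i0_conj b1 mulrA -iotaM.
  by rewrite mulrN1 opprK.
exists (fun x => (p x).1), (fun x => (p x).2); split.
- by move=> x /pP[].
- by case: (pP 1%g) => [|_ ->//]; apply: group1 (stab_group j).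
- by move=> x /pP[].
by move=> x /pP[].
Qed.

(** Units fixed by [s0] make the cocycle real and let the group generated by [s0] serve as
    complement of N in S. *)
Lemma complex_case (inj : k -> F) : (forall c, iota (inj c) = c *: e) ->
  exists sigma gamma : gT -> gT -> F,
  [/\ [/\ Z2S_n bar (stab_group j) (stab_group e) sigma gamma,
       nondeg (stab_group j) sigma,
       abelian S &
       exists T : {group gT}, (N \x T = S)%g /\
         forall t x, t \in T -> x \in N -> gamma t x = 1],
     [/\ forall x y, x \in N -> y \in N -> sigma x y = 1 \/ sigma x y = -1,
       forall s x, s \in S -> x \in N -> gamma s x = 1 \/ gamma s x = -1,
       forall g h x, g \in S -> h \in S -> x \in N ->
         gamma (g * h)%g x = gamma g x * gamma h x,
       forall g x y, g \in S -> x \in N -> y \in N ->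
         gamma g (x * y)%g = gamma g x * gamma g y &
       forall x y, x \in N -> y \in N -> gamma x y = sigma x y / sigma y x],
     forall g, cohom_conj bar (stab_group j) (stab_group e) sigma gamma (fun a => a != 0) g,
     forall g, cohom_conj bar (stab_group j) (stab_group e) sigma gamma (fun a => a ^+ 4 = 1) g &
     iso_Ind inj bar (stab_group j) (stab_group e) sigma gamma act].
Proof.
move=> iota_inj'; have [u [v [uP u1 u2 us0]]] := complex_units.
have N2 := complex_stab_sqr; have cent := complex_stab_cent.
have NS := subsetP sub_stab.
have pm1 (c : F) : c * c = 1 -> c = 1 \/ c = -1.
  by move/eqP; rewrite -expr2 sqrf_eq1 => /orP[]/eqP; [left | right].
pose sigma x y := coef v (u x * u y) (x * y)%g.
have uM x y : x \in N -> y \in N -> u x * u y = iota (sigma x y) * u (x * y)%g.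
  by move=> xN yN; rewrite {1}(uM_coef uP xN yN).
pose gamma s x := coef v (act s (u x)) (s * x * s^-1)%g.
have uact s x : s \in S -> x \in N -> act s (u x) = iota (gamma s x) * u (s * x * s^-1)%g.
  move=> sS xN; apply: (coef_graded uP); first exact: stabJ.
    exact/graded_act/(u_graded uP).
  by rewrite -{1}(stabP _ _ sS) -galgM (ue uP).
clearbody sigma gamma.
have Z := twisted_Z2S_n uP act_iota_bar u1 uM uact.
have Iso := twisted_iso uP iota_inj' act_iota_bar u1 uM uact.
have uact' s x : s \in S -> x \in N -> act s (u x) = iota (gamma s x) * u x.
  by move=> sS xN; rewrite uact // cent.
(* Applying [s0] to the product of two units shows that [sigma x y] is its own conjugate; it is also
   a fourth root of unity. *)
have sigma_sqr x y : x \in N -> y \in N -> sigma x y * sigma x y = 1.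
  move=> xN yN; apply: (@real_sqr _ 4) => //; last first.
    by apply: (sigma_order4 uP uM) => //; apply: complex_stab_comm.
  have xyN : (x * y)%g \in N by apply: (groupM (G := stab_group j)).
  apply: (iotau_inj uP xyN); rewrite -uM // -[u x]us0 // -[u y]us0 //.
  by rewrite -galgM uM // galgM conj_iota us0.
have sigma1 x y : x \in N -> y \in N -> sigma x y = 1 \/ sigma x y = -1.
  by move=> xN yN; apply/pm1/sigma_sqr.
have gamma1 s x : s \in S -> x \in N -> gamma s x = 1 \/ gamma s x = -1.
  move=> sS xN; apply: pm1; apply: iota_inj; rewrite iota1.
  have : iota (gamma s x * gamma s x) * (u x * u x) = u x * u x.
    transitivity (act s (u x * u x)).
      by rewrite galgM uact' // iotaCA !mulrA -iotaM.
    have es := stabP _ _ sS.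
    by case: (u2 x xN) => ->; rewrite 1?raddfN /= es.
  by case: (u2 x xN) => ->; rewrite ?mulrN iotae // => /oppr_inj.
have bar1 s c : c = 1 \/ c = -1 -> bar s c = c.
  by rewrite /bar; case: ifP => // _ []->; rewrite ?rmorphN rmorph1.
have [sigma0 [gamma0 [_ [gammag [_ [Zact [Zmul _]]]]]]] := Z.
have notinS s t : s \in S -> t \in S -> s \notin N -> t \notin N -> (s * t)%g \in N.
  by move=> sS tS sN tN; apply/stabP; rewrite galg_actM actN_j // linearN /= actN_j // opprK.
have notinV s : s \notin N -> s^-1%g \notin N by rewrite (groupV (stab_group j)).
have SV s : s \in S -> s^-1%g \in S by rewrite (groupV (stab_group e)).
have s0N : s0 \notin N.
  apply/negP => /stabP; rewrite s0j => jj.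
  have j0 : j = 0.
    apply/eqP; have : 2%:R *: j == 0 by rewrite scaler_nat mulr2n -{1}jj addNr.
    by rewrite scaler_eq0 pnatr_eq0.
  by move: e_neq0; rewrite -iota1 iotaE j0 mulr0 !scaler0 addr0 eqxx.
(* N is central in S, and two elements outside N differ by an element of N. *)
have abS : abelian S.
  apply/centsP => s sS t tS; rewrite /commute.
  have cmN x : x \in N -> forall y, y \in S -> (x * y = y * x)%g.
    by move=> xN y yS; rewrite -{1}(cent y x yS xN) mulgKV.
  have [sN|sN] := boolP (s \in N); first exact: cmN.
  have [tN|tN] := boolP (t \in N); first exact/esym/cmN.
  have mN := notinS s t^-1%g sS (SV _ tS) sN (notinV _ tN).
  have := cmN _ mN t tS; rewrite mulgKV => {1}->.
  by rewrite !mulgA mulgKV.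
(* By the grading, the unit of degree [s0 * s0] commutes with every unit, as [s0] fixes them all;
   [unit_central] applies. *)
have s0s0 : (s0 * s0 = 1)%g.
  have ssN := notinS s0 s0 s0S s0S s0N s0N.
  apply: (unit_central uP ssN) => y yN.
  by rewrite -(u_graded uP ssN) galg_actM !us0.
have cycs0 t : t \in <[s0]>%g -> t = 1%g \/ t = s0.
  case/cycleP => n ->; elim: n => [|n [IHn|IHn]]; first by left.
    by right; rewrite expgS IHn mulg1.
  by left; rewrite expgS IHn s0s0.
exists sigma, gamma; split=> //; [split=> // | split=> // | |].
- move=> x xN h; apply: (unit_central uP xN) => y yN.
  have xy := complex_stab_comm xN yN.
  by rewrite !uM // h // xy.
- exists <[s0]>%G; split.
    apply: etrans (dprodE (G := stab_group j) _ _) _.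
    + apply/centsP => t /cycs0[->|->] x xN; rewrite /commute ?mulg1 ?mul1g //.
      exact: (centsP abS _ s0S _ (NS x xN)).
    + apply/trivgP/subsetP => x /setIP[xN /cycs0[->|xs]]; first exact: set11.
      by rewrite xs (negPf s0N) in xN.
    apply/setP => s; apply/mulsgP/idP => [[x t xN /cycs0[->|->] ->]|sS].
    + by rewrite mulg1; apply: NS.
    + by apply: (groupM (G := stab_group e)) => //; apply: NS.
    have [sN|sN] := boolP (s \in N).
      by exists s 1%g; rewrite ?mulg1 // group1.
    exists (s * s0^-1)%g s0; rewrite ?cycle_id ?mulgKV //.
    exact: notinS (SV _ s0S) _ (notinV _ s0N).
  move=> t x /cycs0[->|->] xN; first by case: (gammag s0 x s0S xN).
  by apply: (iotau_inj uP xN); rewrite -uact' // us0 // iota1 -ce (ue uP).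
- move=> g h x gS hS xN.
  by rewrite Zmul // (cent h x hS xN) (bar1 _ _ (gamma1 h x hS xN)) mulrC.
- move=> g x y gS xN yN; have := Zact g x y gS xN yN.
  rewrite (cent g x gS xN) (cent g y gS yN) (bar1 _ _ (sigma1 x y xN yN)).
  by rewrite -mulrA => /(mulfI (sigma0 x y xN yN)).
- move=> x y xN yN; apply: (mulIf (sigma0 y x yN xN)); rewrite divfK ?sigma0 //.
  have xyN : (x * y)%g \in N by apply: (groupM (G := stab_group j)).
  apply: (iotau_inj uP xyN).
  have := u_graded uP xN (u y); rewrite uact' ?NS // -mulrA !uM // => <-.
  by rewrite (complex_stab_comm yN xN) mulrA -iotaM.
- move=> g; have [f fG fj] := tr g^-1%g.
  exact: (conj_cohom uP act_iota_bar u1 uM uact stab_j_normal stab_e_normal fG fj).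
move=> g; have [f fG fj] := tr g^-1%g.
have [tau [tau1 [tau0 [tauE tauE']]]] :=
  conj_cohom uP act_iota_bar u1 uM uact stab_j_normal stab_e_normal fG fj.
exists tau; split=> //; split=> // x xN.
have := tauE x x xN xN; rewrite N2 // tau1 divr1 => h.
have xgN := conj_in g stab_j_normal xN.
rewrite -[4%N]/(2 * 2)%N exprM expr2.
have /(congr1 (fun c => c ^+ 2)) := h; rewrite exprMn !expr2.
by rewrite !sigma_sqr // mul1r => <-.
Qed.

End Complex.
End Torsor.
End Block.
End GaloisCoordinates.

(** * Existence of Galois coordinates; polynomials over a real closed field *)

Lemma galois_coords (k : fieldType) (gT : finGroupType) (A : falgType k)
    (act : gT -> 'End(A)) : is_Galois_algebra act ->
  exists (I : finType) (x y : I -> A),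
    forall g, \sum_i x i * act g (y i) = (g == 1%g)%:R.
Proof.
move=> [_ [_ [_ [_ surj]]]].
(* The tensor sent to the indicator function of 1 provides the coordinates, one for each pair of
   basis indices. *)
have [M /ffunP hM] := surj [ffun g => (g == 1%g)%:R].
pose n : nat := \dim {:A}.
exists ('I_n * 'I_n)%type, (fun p : 'I_n * 'I_n => M p.1 p.2 *: (vbasis {:A})`_p.1),
  (fun p : 'I_n * 'I_n => (vbasis {:A})`_p.2).
move=> g; have := hM g; rewrite !ffunE pair_bigA /= => <-.
by apply: eq_bigr => p _; rewrite scalerAl.
Qed.

(** Take a root of [p] in [k[i]]. If it is not real, the remainder of [p] modulo the quadratic has
    degree at most 1 and vanishes there, so it is zero. *)
Lemma quadratic_divisor (k : rcfType) (p : {poly k}) : (1 < size p)%N ->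
  (exists a, 'X - a%:P %| p) \/
  exists a b, ('X - a%:P) ^+ 2 + (b ^+ 2)%:P %| p.
Proof.
move=> sp; pose pC := map_poly (real_complex k) p.
have /closed_rootP[w rw] : size pC != 1%N by rewrite size_map_poly neq_ltn sp orbT.
case: w rw => a b rw.
have [b0|b0] := eqVneq b 0.
  left; exists a; rewrite dvdp_XsubCl -(fmorph_root (real_complex k)).
  by rewrite b0 in rw.
right; exists a, b; set d := _ + _.
have sd : size d = 3%N.
  rewrite /d size_polyDl ?size_polyC size_exp_XsubC //.
  by case: (_ != 0).
have d0 : d != 0 by rewrite -size_poly_gt0 sd.
rewrite /dvdp; apply/eqP; set r := p %% d.
have sr : (size r <= 2)%N by rewrite -ltnS -sd ltn_modp.
have : (map_poly (real_complex k) r).[a +i* b]%C = 0.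
  have : pC.[a +i* b]%C = 0 by apply/rootP.
  rewrite /pC {1}(divp_eq p d) rmorphD rmorphM /= hornerD hornerM.
  suff -> : (map_poly (real_complex k) d).[a +i* b]%C = 0 by rewrite mulr0 add0r.
  rewrite /d rmorphD rmorphXn rmorphB /= map_polyX !map_polyC /= !hornerE /=.
  by apply/eqP; rewrite eq_complex /=; apply/andP; split; apply/eqP; ring.
rewrite (@horner_coef_wide _ 2); last by rewrite size_map_poly.
rewrite !big_ord_recl big_ord0 /= !coef_map /= expr0 expr1 mulr1 addr0.
move/eqP; rewrite eq_complex /= !mul0r addr0 add0r subr0 => /andP[/eqP h1 /eqP h2].
have r1 : r`_1 = 0.
  by move/eqP: h2; rewrite mulf_eq0 (negPf b0) orbF => /eqP.
have r0 : r`_0 = 0 by move: h1; rewrite r1 mul0r addr0.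
apply/polyP => i; rewrite coef0.
by case: i => [//|[//|i]]; apply: nth_default; apply: leq_trans sr _.
Qed.

Lemma algebraic (k : fieldType) (A : falgType k) (z : A) :
  exists2 p : {poly k}, p != 0 & horner_alg z p = 0.
Proof.
apply: boolp.contrapT => np.
pose n : nat := \dim {:A}; pose X := [tuple z ^+ i | i < n.+1].
have : free X.
  apply/freeP => c c0 i.
  pose p := \poly_(i < n.+1) c (inord i).
  have pE : horner_alg z p = \sum_(i < n.+1) c i *: X`_i.
    rewrite /p poly_def linear_sum; apply: eq_bigr => l _ /=.
    rewrite linearZ rmorphXn /= horner_algX inord_val.
    by rewrite -scalerAl mul1r (nth_map l) ?size_enum_ord // nth_ord_enum.
  have [p0|p0] := eqVneq p 0; last by case: np; exists p; rewrite // pE.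
  have := congr1 (fun q : {poly k} => q`_i) p0.
  by rewrite coef_poly ltn_ord coef0 inord_val.
move/eqP => dX; have := dimvS (subvf <<X>>).
by rewrite dX size_tuple ltnn.
Qed.

(** * The field eZ(A) over a real closed field is k or k(i) *)

Section RealClosedBlock.
Variables (k : rcfType) (A : falgType k) (e : A).
Hypotheses (ce : central e) (ee : e * e = e) (e_neq0 : e != 0).
Hypothesis eZ_field :
  forall z, central z -> z * e != 0 -> exists2 w, central w & z * w = e.

(** Split linear or quadratic factors off a polynomial killing [z]; by [eZ_domain] either the factor
    kills [z] or induction applies to the cofactor. A linear factor gives [b = 0]. *)
Lemma block_quadratic z : central z -> z * e = z ->
  exists a b : k, (z - a *: e) * (z - a *: e) + b ^+ 2 *: e = 0.
Proof.
move=> hz ze.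
have hza a : central (z - a *: e).
  by move=> y; rewrite mulrBr mulrBl hz -scalerAr -scalerAl ce.
have zae a : (z - a *: e) * e = z - a *: e by rewrite mulrBl ze -scalerAl ee.
pose ev (p : {poly k}) : A := horner_alg z p * e.
have eve p : ev p * e = ev p by rewrite /ev -mulrA ee.
have evM p q : ev (p * q) = ev q * ev p.
  by rewrite mulrC /ev rmorphM /= -[RHS]mulrA -[e * _]ce -[_ * e * e]mulrA ee mulrA.
have evX a : ev ('X - a%:P) = z - a *: e.
  by rewrite /ev rmorphB /= horner_algX horner_algC mulrBl ze -scalerAl mul1r.
have evQ a b : ev (('X - a%:P) ^+ 2 + (b ^+ 2)%:P) = (z - a *: e) * (z - a *: e) + b ^+ 2 *: e.
  rewrite -evX -evM -expr2 /ev rmorphD mulrDl /= horner_algC.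
  by rewrite -scalerAl mul1r.
have [p p0 pz] := algebraic z.
have : ev p = 0 by rewrite /ev pz mul0r.
move: {2}(size p) (leqnn (size p)) => n; elim: n p p0 {pz} => [|n IHn] p p0 sp evp.
  by move: sp; rewrite leqn0 size_poly_eq0 (negPf p0).
have [s1|s1] := leqP (size p) 1.
  have pc : p = (p`_0)%:P by apply: size1_polyC.
  move: evp p0; rewrite pc /ev horner_algC -scalerAl mul1r polyC_eq0 => /eqP.
  by rewrite scaler_eq0 (negPf e_neq0) orbF => ->.
have step d : d %| p -> (1 < size d)%N -> central (ev d) ->
    (ev d = 0 -> exists a b : k, (z - a *: e) * (z - a *: e) + b ^+ 2 *: e = 0) ->
    exists a b : k, (z - a *: e) * (z - a *: e) + b ^+ 2 *: e = 0.
  move=> /dvdpP[q pq] sd hd fin; move: p0 evp sp; rewrite pq.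
  rewrite mulf_eq0 negb_or => /andP[q0 d0]; rewrite evM => evp sp.
  have [/fin//|] := eZ_domain eZ_field hd (eve d) (eve q) evp.
  apply: IHn => //; rewrite -ltnS; apply: leq_trans sp.
  rewrite size_mul //; case: (size d) sd => [|[|m]] // _.
  by rewrite !addnS /= ltnS leq_addr.
have [[a da]|[a [b db]]] := quadratic_divisor s1.
  apply: (step _ da); [by rewrite size_XsubC | by rewrite evX |].
  by rewrite evX => h; exists a, 0; rewrite h mul0r expr0n scale0r addr0.
apply: (step _ db).
- rewrite size_polyDl ?size_polyC size_exp_XsubC //.
  by case: (_ != 0).
- rewrite evQ; move: (hza a); move: (z - _) => w hw y.
  by rewrite mulrDr mulrDl -scalerAr -scalerAl ce mulrA hw -mulrA hw mulrA.
by rewrite evQ => h; exists a, b.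
Qed.

(** Completing the square for a non-scalar [z0] gives [j]. The quadratic equation of any other [z]
    then splits into factors linear in [z], one of which is zero. *)
Lemma block_center_cases :
  (forall z, central z -> z * e = z -> exists a : k, a *: e = z) \/
  exists j : A, [/\ central j, j * e = j, j * j = - e &
    forall z, central z -> z * e = z -> exists a b : k, a *: e + b *: j = z].
Proof.
have [|nsc] := boolp.EM (forall z, central z -> z * e = z -> exists a : k, a *: e = z).
  by left.
right.
have [z0 [hz0 z0e nz0]] : exists z, [/\ central z, z * e = z & ~ exists a : k, a *: e = z].
  apply: boolp.contrapT => h; apply: nsc => z hz ze.
  by apply: boolp.contrapT => nz; apply: h; exists z.
have hza z (a : k) : central z -> central (z - a *: e).
  by move=> hz y; rewrite mulrBr mulrBl hz -scalerAr -scalerAl ce.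
have zae z (a : k) : z * e = z -> (z - a *: e) * e = z - a *: e.
  by move=> ze; rewrite mulrBl ze -scalerAl ee.
have [a [b hab]] := block_quadratic hz0 z0e.
have b0 : b != 0.
  apply/eqP => b0; apply: nz0; exists a; move: hab.
  rewrite b0 expr0n scale0r addr0.
  case/(eZ_domain eZ_field (hza _ a hz0) (zae _ a z0e) (zae _ a z0e)) => /eqP;
    by rewrite subr_eq0 => /eqP.
pose j := b^-1 *: (z0 - a *: e).
have hj : central j by move=> y; rewrite -scalerAr -scalerAl (hza _ a hz0).
have je : j * e = j by rewrite -scalerAl zae.
have jj : j * j = - e.
  rewrite /j -scalerAr -scalerAl scalerA.
  move/eqP: hab; rewrite addr_eq0 => /eqP ->.
  by rewrite scalerN scalerA -expr2 -exprMn mulVf // expr1n scale1r.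
exists j; split=> // z hz ze.
have [c [d hcd]] := block_quadratic hz ze.
have hdj : central (z - c *: e - d *: j).
  by move=> y; rewrite mulrBr mulrBl (hza _ c hz) -scalerAr -scalerAl hj.
have dje : (z - c *: e - d *: j) * e = z - c *: e - d *: j.
  by rewrite mulrBl zae // -scalerAl je.
have dje' : (z - c *: e + d *: j) * e = z - c *: e + d *: j.
  by rewrite mulrDl zae // -scalerAl je.
have : (z - c *: e - d *: j) * (z - c *: e + d *: j) = 0.
  move: hcd (hza _ c hz); move: (z - _) => w hcd hw.
  rewrite mulrBl !mulrDr (hw (d *: j)) addrKA.
  by rewrite -scalerAr -scalerAl scalerA jj scalerN opprK -expr2.
case/(eZ_domain eZ_field hdj dje dje') => /eqP.
  rewrite -addrA -opprD subr_eq0 => /eqP ->.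
  by exists c, d.
rewrite -addrA addrC addr_eq0 => /eqP h; exists c, (- d).
by rewrite scaleNr -[z]opprK -h opprD opprK.
Qed.

End RealClosedBlock.

(** * Roots of unity in k and k(i) *)

Lemma rcf_root1_sqr (k : rcfType) (c : k) n : (0 < n)%N -> c ^+ n = 1 -> c * c = 1.
Proof.
move=> n0 cn; have /eqP : `|c| ^+ n = 1 by rewrite -normrX cn normr1.
rewrite pexpr_eq1 // => /eqP c1.
by rewrite -expr2 -real_normK ?num_real // c1 expr1n.
Qed.

Lemma complex_root1_norm (k : rcfType) (c : k[i]) n : (0 < n)%N -> c ^+ n = 1 ->
  conjc c * c = 1.
Proof.
move=> n0 cn; have /eqP : `|c| ^+ n = 1 by rewrite -normrX cn normr1.
rewrite pexpr_eq1 // => /eqP c1.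
by rewrite mulrC -sqr_normc c1 expr1n.
Qed.

Lemma abelem2_exponent_root (k : numFieldType) (gT : finGroupType) (N : {group gT}) :
  (2.-abelem N)%g -> exists zeta : k, (exponent N).-primitive_root zeta.
Proof.
rewrite abelemE // => /andP[_]; rewrite dvdn_divisors // !inE => /orP[]/eqP ->.
  exists 1; apply/andP; split=> //; apply/forallP => i.
  by rewrite (ord1 i) unity_rootE expr1n !eqxx.
exists (-1); apply/andP; split=> //; apply/forallP => i.
rewrite unity_rootE; case: i => [[|[|//]] /= _].
  have n1 : (-1 == 1 :> k) = false.
    by rewrite -subr_eq0 -opprD oppr_eq0 -[1 + 1]/(2%:R) pnatr_eq0.
  by rewrite expr1 n1.
by rewrite sqrrN expr1n !eqxx.
Qed.

(** * The two cases assembled into real and semi-real torsor data *)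

Section Cases.
Variables (k : rcfType) (gT : finGroupType) (A : falgType k) (act : gT -> 'End(A)).
Hypothesis act_galg : is_Galgebra act.
Hypothesis act_inv : forall a, (forall g, act g a = a) -> exists c : k, a = c%:A.
Variables (I : finType) (xc yc : I -> A).
Hypothesis coordP : forall g, \sum_i xc i * act g (yc i) = (g == 1%g)%:R.
Variables (s : seq 'End(A)).
Hypotheses (us : uniq s) (ss : size s = #|gT|).
Hypothesis sP : forall f : 'End(A), f \in s <-> is_GAut act f.
Variable e : A.
Hypotheses (ce : central e) (ee : e * e = e) (e_neq0 : e != 0).
Hypothesis eZ_field :
  forall z, central z -> z * e != 0 -> exists2 w, central w & z * w = e.

(** The block results are applied with [j = e] and [F = k], so that S and N are the same
    stabiliser. *)
Lemma real_block_case :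
  (forall z, central z -> z * e = z -> exists a : k, a *: e = z) ->
  exists (N : {group gT}) (sigma : gT -> gT -> k),
    real_torsor_datum N sigma /\
    iso_Ind id (fun _ => id) N N sigma (gamma_of sigma) act.
Proof.
move=> onto; pose iota (a : k) := a *: e.
have iotaD a b : iota (a + b) = iota a + iota b by apply: scalerDl.
have iotaM a b : iota (a * b) = iota a * iota b.
  by rewrite /iota -scalerAl -scalerAr ee scalerA.
have iota1 : iota 1 = e by apply: scale1r.
have iotaE a : iota a = id a *: (e * e) + (fun=> 0) a *: e.
  by rewrite /iota ee scale0r addr0.
have [u0 [v0 u0P]] := unit_choice act_galg act_inv coordP ce ee e_neq0 eZ_field ce ee
  iota1 iotaE onto.
have orbit := gaut_block_orbit act_galg act_inv coordP ce ee e_neq0 eZ_field.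
have tr := gaut_transitive act_galg act_inv coordP ce ee e_neq0 eZ_field ce ee
  iotaD iotaM iota1 iotaE onto u0P us ss sP orbit.
have sep := chi_separates act_galg act_inv coordP ce ee e_neq0 eZ_field ce ee
  iotaD iotaM iota1 iotaE u0P us ss sP orbit.
have sqrtk (c : k) : c != 0 -> exists2 d, d != 0 & d * d * c = 1 \/ d * d * c = -1.
  move=> c0; have nc0 : Num.sqrt `|c| != 0 by rewrite sqrtr_eq0 -ltNge normr_gt0.
  exists (Num.sqrt `|c|)^-1; first by rewrite invr_eq0.
  rewrite -invfM -expr2 sqr_sqrtr ?normr_ge0 //.
  have [c_ge0|c_lt0] := ger0P c; first by left; rewrite mulVf.
  by right; rewrite invrN mulNr mulVf.
have [sigma [sig1 Z nd coh iso]] := real_case act_galg act_inv coordP ce ee e_neq0 eZ_field ce ee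
  iotaD iotaM iota1 iotaE tr u0P (sep onto) erefl (@rcf_root1_sqr k) sqrtk (fun=> erefl).
exists (stab_group act_galg e), sigma; split=> //.
have [_ [_ [Z1 [_ [Zass _]]]]] := Z.
split; first exact: (stab_j_normal act_galg tr).
split.
  apply: stab_abelem => z.
  exact: (real_stab_sqr act_galg coordP ce e_neq0 ce iotaD iotaM iota1 iotaE u0P (sep onto) (@rcf_root1_sqr k)).
do 4![split=> //].
by move=> g _; have [tau [t1 t2 t3]] := coh g; exists tau.
Qed.

Lemma complex_block_case (j : A) : central j -> j * e = j -> j * j = - e ->
  (forall z, central z -> z * e = z -> exists a b : k, a *: e + b *: j = z) ->
  exists (S N : {group gT}) (eps : gT -> bool) (sigma gamma : gT -> gT -> k[i]),
    semi_real_torsor_datum S N eps sigma gamma /\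
    iso_Ind (@inC k) (conj_or_id eps) N S sigma gamma act.
Proof.
move=> cj je jj onto'.
(* The sign compensates for [j * j = - e]. *)
pose re (w : k[i]) : k := - (let: (a +i* _)%C := w in a).
pose im (w : k[i]) : k := let: (_ +i* b)%C := w in b.
pose iota w := re w *: (j * j) + im w *: j.
have iotaC a b : iota (a +i* b)%C = a *: e + b *: j.
  by rewrite /iota /re /im jj scaleNr scalerN opprK.
have iotaD a b : iota (a + b) = iota a + iota b.
  by case: a b => [a a'] [b b']; rewrite !iotaC !scalerDl addrACA.
have ej : e * j = j by rewrite -ce je.
have iotaM a b : iota (a * b) = iota a * iota b.
  case: a b => [a a'] [b b']; rewrite !iotaC mulrDr !mulrDl.
  rewrite -!scalerAr -!scalerAl ee ej je jj !scalerA scalerN -scaleNr.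
  rewrite addrACA [X in _ = _ + X]addrC addrACA -!scalerDl.
  by congr (_ *: _ + _ *: _); ring.
have iota1 : iota 1 = e by rewrite [LHS]iotaC scale1r scale0r addr0.
have iotaE w : iota w = re w *: (j * j) + im w *: j by [].
have onto z : central z -> z * e = z -> exists w, iota w = z.
  by move=> hz ze; have [a [b <-]] := onto' z hz ze; exists (a +i* b)%C; rewrite iotaC.
have sqrt_e z : central z -> z * e = z -> z * z = - e -> z = j \/ z = - j.
  move=> hz ze zz.
  have hzj : central (z - j) by move=> y; rewrite mulrBr mulrBl hz cj.
  have zje : (z - j) * e = z - j by rewrite mulrBl ze je.
  have zje' : (z + j) * e = z + j by rewrite mulrDl ze je.
  have zj0 : (z - j) * (z + j) = 0.
    by rewrite mulrBl !mulrDr (hz j) addrKA zz jj subrr.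
  by case: (eZ_domain eZ_field hzj zje zje' zj0) => /eqP;
    rewrite ?subr_eq0 ?addr_eq0 => /eqP; [left | right].
have actS_j t : t \in stab act e -> act t j = j \/ act t j = - j.
  rewrite inE => /eqP te; apply: sqrt_e; first exact: (central_act act_galg).
    by rewrite -{1}te -(galgM act_galg) je.
  by rewrite -(galgM act_galg) jj linearN /= te.
(* If S fixed [j], then [e] times the trace of [j] would be [#|S|] times [j], the other terms dying
   on the block. As the trace is scalar, [j] would be a k-multiple of [e], against [j * j = - e]. *)
have [s0 s0S s0j] : exists2 s0, s0 \in stab act e & act s0 j = - j.
  apply: boolp.contrapT => nS.
  have fixj t : t \in stab act e -> act t j = j.
    by move=> tS; case: (actS_j t tS) => // tj; case: nS; exists t.
  have [c hc] := tr_scalar act_galg act_inv j.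
  have := congr1 ( *%R e) hc; rewrite -scalerAr mulr1 /tr mulr_sumr.
  rewrite (bigID (mem (stab act e))) /= [X in _ + X]big1 => [|g gS].
    rewrite addr0 (eq_bigr (fun=> j)) => [|g gS]; last by rewrite fixj.
    rewrite sumr_const -scaler_nat => jc; pose d : k := #|stab act e|%:R^-1 * c.
    have jd : j = d *: e.
      rewrite /d -scalerA -jc scalerA mulVf ?scale1r // pnatr_eq0 -lt0n.
      exact: (cardG_gt0 (stab_group act_galg e)).
    move/eqP: jj; rewrite {1 2}jd -scalerAr -scalerAl ee scalerA -subr_eq0 opprK.
    rewrite -{2}[e]scale1r -scalerDl scaler_eq0 (negPf e_neq0) orbF.
    by rewrite gt_eqF // -expr2 ltr_wpDl ?sqr_ge0.
  rewrite -je (galgM act_galg) -ce -mulrA.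
  by rewrite (block_orth act_galg ce ee eZ_field gS) mulr0.
have conj_iota a : act s0 (iota a) = iota (conjc a).
  have s0e : act s0 e = e by move: s0S; rewrite inE => /eqP.
  by case: a => a b; rewrite /= !iotaC linearD !linearZ /= s0e s0j scalerN scaleNr.
have actN_j t : t \in stab act e -> t \notin stab act j -> act t j = - j.
  by move=> tS; rewrite inE; case: (actS_j t tS) => ->; rewrite ?eqxx.
(* Choose [t] with [f e = act t e]. Then [act t^-1 (f j)] is a square root of [- e] in eZ(A), so it
   is [j] or [- j], and [s0] corrects the sign. *)
have orbit f : is_GAut act f -> exists t, f j = act t j.
  move=> fG; have [fM _] := fG.
  have [t fe] := gaut_block_orbit act_galg act_inv coordP ce ee e_neq0 eZ_field fG.
  have : act t^-1%g (f j) = j \/ act t^-1%g (f j) = - j.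
    have eV : e = act t^-1%g (f e) by rewrite fe (galgK act_galg).
    apply: sqrt_e.
    - by apply: (central_act act_galg); apply: (gaut_central fG).
    - by rewrite {1}eV -(galgM act_galg) -fM je.
    by rewrite -(galgM act_galg) -fM jj !linearN /= -eV.
  case=> h; [exists t | exists (t * s0)%g].
    by rewrite -[in RHS]h (galgVK act_galg).
  by rewrite (galg_actM act_galg) s0j -[in RHS]h (galgVK act_galg).
have [u0 [v0 u0P]] := unit_choice act_galg act_inv coordP ce ee e_neq0 eZ_field cj je
  iota1 iotaE onto.
have tr := gaut_transitive act_galg act_inv coordP ce ee e_neq0 eZ_field cj je
  iotaD iotaM iota1 iotaE onto u0P us ss sP orbit.
have sep := chi_separates act_galg act_inv coordP ce ee e_neq0 eZ_field cj je
  iotaD iotaM iota1 iotaE u0P us ss sP orbit.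
have conj_real (c : k[i]) n : (0 < n)%N -> conjc c = c -> c ^+ n = 1 -> c * c = 1.
  by move=> n0 {2}<- /(complex_root1_norm n0).
have sqrtC_ex (c : k[i]) : exists d, d * d = c by exists (sqrtc c); rewrite -expr2 sqr_sqrtc.
have i2 : ('i : k[i])%C * 'i%C = -1.
  by apply/eqP; rewrite eq_complex /=; apply/andP; split; apply/eqP; ring.
have iN : conjc ('i : k[i])%C = - 'i%C.
  by apply/eqP; rewrite eq_complex /= oppr0 !eqxx.
have injE c : iota (inC c) = c *: e by rewrite [LHS]iotaC scale0r addr0.
have N2 := complex_stab_sqr act_galg act_inv coordP ce ee e_neq0 eZ_field cj je
  iotaD iotaM iota1 iotaE tr u0P (sep onto) s0j conj_iota conj_real.
have [sigma [gamma [[Z nd abS [T [NT gT1]]] [sig1 gam1 gamM1 gamM2 gamalt] coh coh4 iso]]] :=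
  complex_case act_galg act_inv coordP ce ee e_neq0 eZ_field cj je
  iotaD iotaM iota1 iotaE tr u0P (sep onto) s0S s0j actN_j conj_iota
  (@complex_root1_norm k) conj_real sqrtC_ex i2 iN injE.
pose eps g := g \notin stab act j.
exists (stab_group act_galg e), (stab_group act_galg j), eps, sigma, gamma; split=> //.
have NG := stab_j_normal act_galg tr.
have SG := stab_e_normal act_galg iota1 iotaE tr.
have abelN := stab_abelem act_galg N2.
have NS : (stab_group act_galg j <| stab_group act_galg e)%g.
  by apply: normalS NG; rewrite ?subsetT // (sub_stab act_galg iota1 iotaE).
have jN : j != - j.
  apply/eqP => jj'; have : 2%:R *: j == 0 by rewrite scaler_nat mulr2n {2}jj' subrr.
  rewrite scaler_eq0 pnatr_eq0 => /eqP j0; move: e_neq0.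
  by rewrite -oppr_eq0 -jj j0 mulr0 eqxx.
have pm1C (c : k[i]) : c = 1 \/ c = -1 -> exists2 d : k, d != 0 & c = inC d.
  case=> ->; [exists 1; rewrite ?oner_eq0 // | exists (-1); rewrite ?oppr_eq0 ?oner_eq0 //].
  by rewrite /inC rmorphN rmorph1.
split=> //; split.
  move=> s1 s2 s1S s2S; rewrite /eps !inE (galg_actM act_galg).
  case: (actS_j s1 s1S) => h1; case: (actS_j s2 s2S) => h2;
    by rewrite h2 ?linearN /= h1 ?opprK ?eqxx // eq_sym jN.
split; first by move=> s1 _; rewrite negbK.
split.
  by exists s0; split=> //; rewrite /eps inE s0j eq_sym jN.
do 3![split=> //]; split; first by exists T.
split; first exact: abelem2_exponent_root.
split; first by move=> x y xN yN; have [d _ ->] := pm1C _ (sig1 x y xN yN); exists d.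
split; first by move=> g x gS xN; have [d d0 ->] := pm1C _ (gam1 g x gS xN); exists d.
do 6![split=> //]; split; first exact: (abelem_abelian abelN).
by split; first exact: (abelem_pgroup abelN).
Qed.

End Cases.

Theorem theorem3p14 (gT : finGroupType) (k : rcfType) (A : falgType k)
    (act : gT -> 'End(A)) :
  is_Galois_algebra act ->
  card_AutG_eq act #|[set: gT]| ->
  (exists (S N : {group gT}) (eps : gT -> bool) (sigma gamma : gT -> gT -> k[i]),
      semi_real_torsor_datum S N eps sigma gamma /\
      iso_Ind (@inC k) (conj_or_id eps) N S sigma gamma act)
  \/
  (exists (N : {group gT}) (sigma : gT -> gT -> k),
      real_torsor_datum N sigma /\
      iso_Ind id (fun _ => id) N N sigma (gamma_of sigma) act).
Proof.
move=> gal [s [us [ss sP]]]; rewrite cardsT in ss.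
have [I [x [y coordP]]] := galois_coords gal.
have [galg [_ [inv _]]] := gal.
have [e [ce ee e0 eZ]] := exists_block galg inv coordP.
have [onto|[j [cj je jj onto]]] := block_center_cases ce ee e0 eZ.
  by right; apply: (real_block_case galg inv coordP us ss sP ce ee e0 eZ onto).
by left; apply: (complex_block_case galg inv coordP us ss sP ce ee e0 eZ cj je jj onto).
Qed.
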